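(* Let $f_0:[-1,1]\to\mathbb{R}$ be nondecreasing and continuous at $0$. For each nondecreasing $f:[-1,1]\to\mathbb R$ let $\mathbb{P}_f$ be the law under which one observes $(X_i,Y_i)$, $i=1,\dots,n$, with $Y_i=f(X_i)+\varepsilon_i$, where $X_1,\dots,X_n$ are i.i.d. in $[-1,1]$ with distribution function $G$, independent of the i.i.d. mean-zero errors $\varepsilon_i$. Suppose that: (1) $\mathrm{Var}(\varepsilon_i)=\sigma^2<\infty$ and $\varepsilon_i$ has a density $\phi$ with respect to Lebesgue measure for which there exists $M>0$ with $\int_{-\infty}^\infty(\phi^{1/2}(y-a)-\phi^{1/2}(y))^2\,dy\le Ma^2$ for all $a\in\mathbb{R}$; (2) $G$ has a density $g$ with respect to Lebesgue measure in a neighborhood of $0$, with $g$ continuous at $0$ and $g(0)>0$. Let $\hat f$ be the monotone least squares estimator (defined in the context). Choose $\alpha\in(0,1)$ and $\beta\in(0,1/2)$. There exists $\eta>0$ such that for all $n$ large enough we can find a nondecreasing function $f_1=f_{1,n}$ on $[-1,1]$ and a rate $\gamma_n>0$ with $$\limsup_{n\to\infty}\ \max_{i=0,1}\ \mathbb{P}_{f_i}\big(|\hat f(0)-f_i(0)|\ge\gamma_n\big)\le\alpha$$ and $$\liminf_{n\to\infty}\ \inf_{\hat\theta}\ \max_{i=0,1}\ \mathbb{P}_{f_i}\big(|\hat\theta(Y,X)-f_i(0)|\ge\eta\cdot\gamma_n\big)>\beta,$$ where the infimum is over all estimators $\hat\theta(Y,X)$ of $f(0)$, i.e. all real-valued measurable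 functions of the data $(Y,X)$.
   Context: Estimator: let $X_{(1)}\le\dots\le X_{(n)}$ be the order statistics of the design points and relabel the observations so that $Y_i$ is the response at $X_{(i)}$. For $0\le t\le n$ set $h(t)=\sum_{i=1}^nY_i1_{\{i-1<t\le i\}}$, $H(t)=\int_0^th(s)\,ds$, $\tilde F(t)=\sup\{\phi(t):\phi\text{ affine and }\phi(s)\le H(s)\ \forall\,0\le s\le n\}$, $\tilde f(t)=\lim_{h\downarrow0}(\tilde F(t)-\tilde F(t-h))/h$, and $\hat f(t)=\tilde f(m)$ where $m$ is such that $X_{(m-1)}<t\le X_{(m)}$ (such $m$ with $1<m<n$ exists for $t=0$ with probability tending to $1$; otherwise the value of $\hat f(0)$ is irrelevant). The function $f_1$ may depend on $n$; $\eta$ does not. *)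

(* Defs.v *)
From HB Require Import structures.
From mathcomp Require Import all_boot all_order all_algebra.
From mathcomp Require Import all_classical all_reals all_analysis.

Set Implicit Arguments.
Unset Strict Implicit.
Unset Printing Implicit Defensive.

Import Order.TTheory GRing.Theory Num.Theory.
Import numFieldNormedType.Exports.

Local Open Scope classical_set_scope.
Local Open Scope ring_scope.

Section iid.
Context d (T : measurableType d) (R : realType).

Definition pcons n (p : T * n.-tuple T) : n.+1.-tuple T :=
  [tuple of p.1 :: p.2].

Lemma measurable_pcons n : measurable_fun [set: T * n.-tuple T] (@pcons n).
Proof. exact: measurable_cons measurable_fst measurable_snd. Qed.

HB.instance Definition _ n :=
  isMeasurableFun.Build _ _ _ _ (@pcons n) (@measurable_pcons n).

(* The law of n independent random variables with common law P. *)
Fixpoint iid_law (P : probability T R) n : probability (n.-tuple T) R :=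
  if n is n'.+1 then distribution (P \x iid_law P n')%E (@pcons n')
  else \d_[tuple].

End iid.

Section model.
Context (R : realType).
Local Notation TR := (measurableTypeR R).

(* The law on the real line with distribution function G. *)
Definition law_of_cdf (G : cumulativeBounded (0 : R) (1 : R)) :
  probability TR R := lebesgue_stieltjes_measure G.

(* On the measurable set U, the measure mu has density g with respect to
   Lebesgue measure. *)
Definition has_density_on (U : set TR) (mu : set TR -> \bar R) (g : R -> R) :=
  [/\ measurable_fun U g,
      (forall x, U x -> 0 <= g x) &
      forall A : set TR, measurable A -> A `<=` U ->
        mu A = (\int[lebesgue_measure]_(x in A) (g x)%:E)%E].

(* Functions on [-1, 1] are represented by functions on R whose values outside
   [-1, 1] play no role. *)
Definition nondecreasing_on_itv (f : R -> R) :=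
  {in `[-1, 1] &, {homo f : u v / u <= v}}.

(* The data (Y, X), as a function of the design points and the errors: the
   restriction [f \_ _], zero outside [-1, 1], agrees with f at the design
   points and is Borel whenever f is nondecreasing on [-1, 1]. *)
Definition observe n (f : R -> R) (w : n.-tuple TR * n.-tuple TR) :
    n.-tuple TR * n.-tuple TR :=
  ([tuple (f \_ `[-1, 1]) (tnth w.1 i) + tnth w.2 i | i < n], w.1).

(* The law P_f of the data (Y, X), for i.i.d. design points with distribution
   function G, independent of i.i.d. errors with law Q. *)
Definition data_law (G : cumulativeBounded (0 : R) (1 : R))
    (Q : probability TR R) n (f : R -> R) :
    set (n.-tuple TR * n.-tuple TR) -> \bar R :=
  pushforward (iid_law (law_of_cdf G) n \x iid_law Q n)%E (observe f).

(* max_(i = 0, 1) P_(f_i) (|theta (Y, X) - f_i 0| >= r) *)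
Definition max_error_prob (G : cumulativeBounded (0 : R) (1 : R))
    (Q : probability TR R) n (f0 f1 : R -> R)
    (theta : n.-tuple TR * n.-tuple TR -> R) (r : R) : \bar R :=
  maxe (data_law G Q f0 [set yx | r <= `|theta yx - f0 0|])
       (data_law G Q f1 [set yx | r <= `|theta yx - f1 0|]).

End model.

Section estimator.
Context (R : realType) (n : nat).
Implicit Types (y x : n.-tuple (measurableTypeR R)) (t : R).

(* The observations (X_i, Y_i) sorted by design point; the sort is stable, so
   tied design points keep their original order. *)
Definition sorted_obs y x : seq (R * R) :=
  sort (fun p q : R * R => p.1 <= q.1) (zip x y).

(* [ordX y x i] is the order statistic X_(i) and [ordY y x i] the response at
   X_(i), with 1 <= i <= n. *)
Definition ordX y x (i : nat) : R := (nth (0, 0) (sorted_obs y x) i.-1).1.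
Definition ordY y x (i : nat) : R := (nth (0, 0) (sorted_obs y x) i.-1).2.

Definition step_h y x t : R :=
  \sum_(1 <= i < n.+1) ordY y x i * \1_`](i.-1)%:R, i%:R] t.

Definition cusum y x t : R :=
  \int[lebesgue_measure]_(s in `[0, t]) step_h y x s.

(* Greatest convex minorant of [cusum] on [0, n], as the supremum of its affine
   minorants. *)
Definition gcm y x t : R :=
  sup [set z | exists a b : R,
    z = a * t + b /\ forall s, 0 <= s <= n%:R -> a * s + b <= cusum y x s].

Definition gcm_slope y x t : R :=
  lim ((gcm y x t - gcm y x (t - h)) / h @[h --> 0^'+]).

(* The value of the estimator is irrelevant when no rank 1 < m < n satisfies
   X_(m-1) < t <= X_(m); it is set to 0. *)
Definition lse t
    (yx : n.-tuple (measurableTypeR R) * n.-tuple (measurableTypeR R)) : R :=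
  let: (y, x) := yx in
  if [pick m : 'I_n | (1 < m)%N && (ordX y x m.-1 < t <= ordX y x m)]
  is Some m then gcm_slope y x (m : nat)%:R else 0.

End estimator.

(* Main.v *)
Require Import Defs.
From mathcomp Require Import all_boot all_order all_algebra.
From mathcomp Require Import all_classical all_reals all_analysis.
From mathcomp Require Import measurable_realfun.
From mathcomp Require Import ring lra.

(** Write w(delta) = c / sqrt (n delta). For each n, delta is the largest 2^-k,
    with k >= 0, for which f0 delta - f0 (- delta) is at most w(delta): this
    bandwidth balances the oscillation of f0 around 0 against the standard
    deviation of an average over the roughly n delta design points that fall
    within distance delta of 0. The rate gamma_n is a constant times w(delta).

    Since delta is critical, f0 moves by more than w(delta) / 4 within distance
    2 delta on one of the two sides of 0 (or delta = 1). The function f1 raises f0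
    to at least the level f0 0 + w(delta) / 4 on the right of 0, or lowers it on the left
    of 0, whichever alters f0 only within distance 2 delta of 0
    ([local_alternative]). So f1 0 and f0 0 differ by w(delta) / 4, whereas the
    squared distance of f0 and f1 in L2 of the design is of order
    delta w(delta)^2 = c^2 / n.

    Lower bound. By the Hellinger condition the affinity of the two conditional
    laws of one response is at least 1 - M (f0 x - f1 x)^2 / 2. Affinities
    multiply over independent observations ([n_obs_lower_bound]), which bounds
    the sum of the two errors of every test from below ([two_point_inequality]).
    For small c this sum exceeds any number below 1, hence one of the errors
    exceeds any number below 1 / 2 ([minimax_two_point]).

    Upper bound. The left slope of the greatest convex minorant at rank m is the
    maximum over s <= m of the minimum over t >= m of the averages of the
    responses of ranks s, ..., t. Fixing t as the last rank with design point at
    most delta bounds the estimator from above by f delta plus the largest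
    average of errors over blocks that end there; fixing s as the first rank with
    design point at least - delta bounds it from below ([lse_bounds]). Given
    the design, these averages are S_k / k for one random walk S and k at least
    the number N of design points between 0 and delta, respectively - delta, so
    the Hajek-Renyi inequality makes their maximum of order 1 / sqrt N
    ([iid_maximal_inequality]), and N is of order n delta by Chebyshev's
    inequality ([iid_count_lower]). This gives an error of order w(delta) under
    f0 and f1 alike ([lse_deviation]), provided that n delta tends to infinity,
    which the continuity of f0 at 0 ensures ([bandwidth_not_too_small]). *)

Set Implicit Arguments.
Unset Strict Implicit.
Unset Printing Implicit Defensive.

Import Order.TTheory GRing.Theory Num.Theory.
Import numFieldNormedType.Exports.

Local Open Scope classical_set_scope.
Local Open Scope ring_scope.

(** * Laws of i.i.d. tuples *)

Section tuple_laws.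
Local Open Scope ereal_scope.

(** The integral of a nonnegative function is a supremum over the simple
    functions below it, so it is monotone on all functions. Together with
    [iid_law_mono] this bounds the probability of an event about the estimator
    by that of an explicit measurable event that contains it. *)
Lemma ge0_integral_mono d (T : measurableType d) (R : realType)
    (mu : {measure set T -> \bar R}) (f h : T -> \bar R) :
  (forall x, 0 <= f x) -> (forall x, f x <= h x) ->
  \int[mu]_x f x <= \int[mu]_x h x.
Proof.
move=> f0 fh; rewrite !ge0_integralTE//; last first.
  by move=> x; exact: le_trans (f0 x) (fh x).
apply: le_ereal_sup => _ [k /= kf <-]; exists k => // x.
exact: le_trans (kf x) (fh x).
Qed.

Lemma product_measure1_mono d1 d2 (T1 : measurableType d1)
    (T2 : measurableType d2) (R : realType) (m1 : {measure set T1 -> \bar R})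
    (m2 : {measure set T2 -> \bar R}) :
  {homo m2 : A B / A `<=` B >-> A <= B} ->
  {homo m1 \x m2 : A B / A `<=` B >-> A <= B}.
Proof.
move=> m2_mono A B AB; apply: ge0_integral_mono => [x|x] /=; first exact: measure_ge0.
by apply: m2_mono => y; rewrite /xsection /= !inE; exact: AB.
Qed.

Lemma integral_probability_cst d (T : measurableType d) (R : realType)
    (P : probability T R) (c : \bar R) : \int[P]_x c = c.
Proof. by rewrite (integral_cst P measurableT) [X in _ * X](probability_setT P) mule1. Qed.

Context d (T : measurableType d) (R : realType) (P : probability T R).

(** The law of a tuple is an iterated integral of point masses, and each of
    these operations is monotone on all sets. *)
Lemma iid_law_mono n : {homo iid_law P n : A B / A `<=` B >-> A <= B}.
Proof.
elim: n => [|n IH] A B AB /=.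
  rewrite /dirac /= lee_fin !indicE ler_nat.
  by case: (boolP (_ \in A)) => //; rewrite inE => /AB/mem_set ->.
rewrite /distribution /pushforward.
apply: (@product_measure1_mono _ _ _ _ _ P (iid_law P n) IH) => x; exact: AB.
Qed.

Lemma integral_iid_cons n (F : n.+1.-tuple T -> \bar R) :
  measurable_fun [set: n.+1.-tuple T] F -> (forall t, 0 <= F t) ->
  \int[iid_law P n.+1]_t F t = \int[P]_x \int[iid_law P n]_t F (pcons (x, t)).
Proof.
move=> mF F0; rewrite /= ge0_integral_distribution//.
by rewrite fubini_tonelli1//=; exact: measurableT_comp.
Qed.

Definition set_coord n (t : n.-tuple T) (i : 'I_n) (z : T) : n.-tuple T :=
  [tuple if j == i then z else tnth t j | j < n].

Lemma tnth_set_coord n (t : n.-tuple T) i z j :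
  tnth (set_coord t i z) j = if j == i then z else tnth t j.
Proof. by rewrite tnth_mktuple. Qed.

Lemma measurable_set_coord n (i : 'I_n) :
  measurable_fun [set: n.-tuple T * T] (fun p => set_coord p.1 i p.2).
Proof.
apply/measurable_fun_tnthP => j.
rewrite (_ : _ \o _ = if j == i then snd else (@tnth _ T ^~ j) \o fst).
  case: ifP => _; first exact: measurable_snd.
  exact: measurableT_comp (measurable_tnth j) measurable_fst.
by apply/funext => p /=; rewrite tnth_set_coord; case: ifP.
Qed.

Lemma tnth_pcons0 n (x : T) (t : n.-tuple T) : tnth (pcons (x, t)) ord0 = x.
Proof. by []. Qed.

Lemma tnth_pconsS n (x : T) (t : n.-tuple T) j :
  tnth (pcons (x, t)) (lift ord0 j) = tnth t j.
Proof. by rewrite /pcons tnthS. Qed.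

Lemma set_coord_pcons0 n (x z : T) (t : n.-tuple T) :
  set_coord (pcons (x, t)) ord0 z = pcons (z, t).
Proof.
apply: eq_from_tnth => j; rewrite tnth_set_coord.
case: (unliftP ord0 j) => [k|] ->.
  by rewrite !tnth_pconsS.
by rewrite eqxx.
Qed.

Lemma set_coord_pconsS n (x z : T) (t : n.-tuple T) i :
  set_coord (pcons (x, t)) (lift ord0 i) z = pcons (x, set_coord t i z).
Proof.
apply: eq_from_tnth => j; rewrite tnth_set_coord.
case: (unliftP ord0 j) => [k|] ->.
  by rewrite !tnth_pconsS tnth_set_coord (inj_eq lift_inj).
by rewrite !tnth_pcons0.
Qed.

(** Redrawing one coordinate leaves the law unchanged. This is conditioning on
    the other coordinates, and it makes it possible to integrate the
    coordinates out in any order, here the one given by the ranks of the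
    design points. *)
Lemma integral_iid_resample n (i : 'I_n) (F : n.-tuple T -> \bar R) :
  measurable_fun [set: n.-tuple T] F -> (forall t, 0 <= F t) ->
  \int[iid_law P n]_t F t = \int[iid_law P n]_t \int[P]_z F (set_coord t i z).
Proof.
elim: n i F => [[]//|n IH] i F mF F0.
have mFset : measurable_fun [set: n.+1.-tuple T * T] (fun p => F (set_coord p.1 i p.2)).
  exact: measurableT_comp mF (measurable_set_coord i).
have mG : measurable_fun [set: n.+1.-tuple T] (fun t => \int[P]_z F (set_coord t i z)).
  exact: (measurable_fun_fubini_tonelli_F _ mFset).
rewrite !integral_iid_cons//; last by move=> t; exact: integral_ge0.
have mFc : measurable_fun [set: T * n.-tuple T] (F \o @pcons _ T n).
  exact: measurableT_comp mF (@measurable_pcons _ _ _).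
case: (unliftP ord0 i) => [k|] ->.
  apply: eq_integral => x _.
  rewrite (IH k)//; first by under [RHS]eq_integral do under eq_integral do rewrite set_coord_pconsS.
  exact: measurableT_comp mFc (pair1_measurable x).
under [RHS]eq_integral do under eq_integral do under eq_integral do rewrite set_coord_pcons0.
rewrite integral_probability_cst.
Time pose proof (@fubini_tonelli1 _ _ _ _ _ P (iid_law P n) _ mFc) as E1.
Time pose proof (@fubini_tonelli2 _ _ _ _ _ P (iid_law P n) _ mFc) as E2.
by rewrite /fubini_F /fubini_G /= in E1 E2; rewrite -E1// -E2.
Qed.

End tuple_laws.

(** * A maximal inequality for sums of coordinates *)

Lemma measurable_bool_set d (T : measurableType d) (b : T -> bool) :
  measurable_fun [set: T] b -> measurable [set x | b x].
Proof.
move=> mb; have := mb measurableT [set true] Logic.I.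
by rewrite setTI; congr measurable; apply/seteqP; split.
Qed.

Section maximal_inequality.
Local Open Scope ereal_scope.
Context d (T : measurableType d) (R : realType) (P : probability T R).
Variables (psi : T -> R) (v : R).
Hypothesis psi_int : P.-integrable [set: T] (EFin \o psi).
Hypothesis psi_mean : \int[P]_z (psi z)%:E = 0.
Hypothesis psi_var : \int[P]_z (psi z ^+ 2)%:E = v%:E.

Let mpsi : measurable_fun [set: T] psi.
Proof. exact/measurable_EFinP/measurable_int/psi_int. Qed.

Let v_ge0 : (0 <= v)%R.
Proof.
by rewrite -lee_fin -psi_var; apply: integral_ge0 => z _; rewrite lee_fin sqr_ge0.
Qed.

(** The cross term vanishes because psi is centred. *)
Lemma integral_shifted_sqr (A B s : R) : (0 <= A)%R -> (0 <= B)%R ->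
  \int[P]_z (A * (s + psi z) ^+ 2 + B)%:E = (A * (s ^+ 2 + v) + B)%:E.
Proof.
move=> A0 B0.
have iq : P.-integrable [set: T] (EFin \o (fun z => psi z ^+ 2)%R).
  apply/integrableP; split; first exact/measurable_EFinP/measurable_funX.
  under eq_integral do rewrite /= ger0_norm ?sqr_ge0//.
  by rewrite psi_var ltry.
have ic : P.-integrable [set: T] (EFin \o cst (A * s ^+ 2 + B)%R).
  exact: finite_measure_integrable_cst.
have i1 := integrableZl measurableT A iq.
have i2 := integrableZl measurableT (2 * A * s)%R psi_int.
rewrite (eq_integral (fun z => (A%:E * (psi z ^+ 2)%:E +
    (2 * A * s)%:E * (psi z)%:E) + (A * s ^+ 2 + B)%:E)); last first.
  by move=> z _; rewrite -!EFinM -!EFinD; congr EFin; ring.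
rewrite integralD//; last exact: integrableD.
rewrite integralD// !integralZl// psi_var psi_mean mule0 adde0.
by rewrite integral_probability_cst -EFinM -EFinD; congr EFin; ring.
Qed.

Variable n : nat.
Implicit Types (l : seq 'I_n) (t : n.-tuple T).

Let mpsi_tnth i : measurable_fun [set: n.-tuple T] (fun t => psi (tnth t i)).
Proof. exact: measurableT_comp mpsi (measurable_tnth i). Qed.

(** Redrawing the first index of l shows that each term adds v. *)
Lemma iid_second_moment l : uniq l ->
  \int[iid_law P n]_t ((\sum_(i <- l) psi (tnth t i)) ^+ 2)%:E =
  ((size l)%:R * v)%:E.
Proof.
elim: l => [_|i l IH /= /andP[il /IH {}IH]].
  under eq_integral do rewrite big_nil expr0n.
  by rewrite integral_probability_cst mul0r.
have mS (l' : seq 'I_n) : measurable_fun [set: n.-tuple T]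
    (fun t => \sum_(j <- l') psi (tnth t j))%R by exact: measurable_sum.
have mS2 (l' : seq 'I_n) : measurable_fun [set: n.-tuple T]
    (fun t => ((\sum_(j <- l') psi (tnth t j)) ^+ 2)%:E).
  exact/measurable_EFinP/measurable_funX.
have inv t z : (\sum_(j <- l) psi (tnth (set_coord t i z) j) =
               \sum_(j <- l) psi (tnth t j))%R.
  apply: eq_big_seq => j jl; rewrite tnth_set_coord; case: eqP => // ji.
  by rewrite -ji jl in il.
rewrite (integral_iid_resample _ i)//; last by move=> t; rewrite lee_fin sqr_ge0.
under eq_integral => t _.
  under eq_integral => z _.
    rewrite big_cons tnth_set_coord eqxx inv addrC.
    rewrite (_ : ((_ + _) ^+ 2)%R = (1 * (\sum_(j <- l) psi (tnth t j) + psi z) ^+ 2 + 0)%R); last by rewrite mul1r addr0.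
    over.
  rewrite integral_shifted_sqr// mul1r addr0 EFinD.
  over.
rewrite ge0_integralD//; last first.
  by move=> t _; rewrite lee_fin sqr_ge0.
rewrite IH integral_probability_cst -EFinD; congr EFin.
by rewrite -natr1; ring.
Qed.

Variable lam : R.
Hypothesis lam_gt0 : (0 < lam)%R.

(** Whether the walk that is at s at time k and then adds psi along l ever has
    absolute value at least lam times the time. *)
Fixpoint hits (s : R) (k : nat) l t : bool :=
  (lam * k%:R <= `|s|)%R ||
  (if l is i :: l' then hits (s + psi (tnth t i)) k.+1 l' t else false).

Lemma measurable_hits l (s : n.-tuple T -> R) k :
  measurable_fun [set: n.-tuple T] s ->
  measurable_fun [set: n.-tuple T] (fun t => hits (s t) k l t).
Proof.
elim: l s k => [|i l IH] s k ms /=; apply: measurable_or => //.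
- by apply: measurable_fun_ler => //; exact: measurableT_comp.
- by apply: measurable_fun_ler => //; exact: measurableT_comp.
- by apply: (IH (fun t => s t + psi (tnth t i))%R); exact: measurable_funD.
Qed.

(** The Hajek-Renyi bound for a walk at s at time k is s^2 / (lam k)^2 plus the sum
    of v / (lam j)^2 over the later times j; that sum is replaced by its upper
    bound v / (lam^2 k). *)
Let potential (k : nat) (s : R) : R :=
  ((lam * k%:R) ^- 2 * s ^+ 2 + v / (lam ^+ 2 * k%:R))%R.

Let potential_ge0 k s : (0 <= potential k s)%R.
Proof.
rewrite /potential addr_ge0// mulr_ge0// ?sqr_ge0// invr_ge0 ?sqr_ge0//.
by rewrite mulr_ge0// sqr_ge0.
Qed.

Let potential_ge1 k s : (0 < k)%N -> (lam * k%:R <= `|s|)%R ->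
  (1 <= potential k s)%R.
Proof.
move=> k0 ks; rewrite /potential.
have lk : (0 < lam * k%:R)%R by rewrite mulr_gt0// ltr0n.
apply: ler_wpDr; first by rewrite divr_ge0// mulr_ge0// sqr_ge0.
rewrite mulrC ler_pdivlMr ?exprn_gt0// mul1r.
by rewrite -(real_normK (num_real s)) lerXn2r ?nnegrE// ltW.
Qed.

(** The potential is a supermartingale along the walk: one step adds v to the mean
    square of the position, at a cost v / (k+1)^2 <= v / k - v / (k+1). *)
Let potential_step k s : (0 < k)%N ->
  \int[P]_z (potential k.+1 (s + psi z))%:E <= (potential k s)%:E.
Proof.
move=> k0; rewrite integral_shifted_sqr; last 2 first.
- by rewrite invr_ge0 sqr_ge0.
- by rewrite divr_ge0// mulr_ge0// sqr_ge0.
rewrite lee_fin /potential.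
have k0' : (0 < k%:R :> R)%R by rewrite ltr0n.
have -> : ((lam * k.+1%:R) ^- 2 * (s ^+ 2 + v) + v / (lam ^+ 2 * k.+1%:R) =
  lam ^- 2 * (s ^+ 2 * k.+1%:R ^- 2 + v * (k.+1%:R ^- 2 + k.+1%:R ^-1)))%R.
  by rewrite -natr1; field; rewrite !gt_eqF// ?ltr_wpDl// ltr_pwDr.
have -> : ((lam * k%:R) ^- 2 * s ^+ 2 + v / (lam ^+ 2 * k%:R) =
  lam ^- 2 * (s ^+ 2 * k%:R ^- 2 + v * k%:R ^-1))%R.
  by field; rewrite !gt_eqF.
apply: ler_wpM2l; first by rewrite invr_ge0 sqr_ge0.
apply: lerD; apply: ler_wpM2l => //; rewrite ?sqr_ge0//.
  by rewrite lef_pV2 ?posrE ?exprn_gt0 ?ltr0n// lerXn2r ?nnegrE// ler_nat.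
rewrite -natr1; set x := k%:R in k0' *.
have -> : (x^-1 = (x + 1) ^- 2 + (x + 1)^-1 + x^-1 * (x + 1) ^- 2)%R.
  by field; rewrite !gt_eqF// ltr_wpDl// ltW.
by rewrite lerDl mulr_ge0// invr_ge0 ?sqr_ge0// ltW.
Qed.

(** Optional stopping by induction on the remaining indices. The event w records
    that the boundary has not been met so far; neither w nor the position s may
    depend on the coordinates still to be added, so that the next one can be
    redrawn. *)
Lemma hits_potential l : uniq l -> forall (w : n.-tuple T -> bool)
    (s : n.-tuple T -> R) k, (0 < k)%N ->
  measurable_fun [set: n.-tuple T] w -> measurable_fun [set: n.-tuple T] s ->
  (forall i t z, i \in l -> w (set_coord t i z) = w t) ->
  (forall i t z, i \in l -> s (set_coord t i z) = s t) ->
  iid_law P n [set t | w t && hits (s t) k l t] <=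
  \int[iid_law P n]_t (if w t then potential k (s t) else 0)%:E.
Proof.
have mpot k (s' : n.-tuple T -> R) : measurable_fun [set: n.-tuple T] s' ->
    measurable_fun [set: n.-tuple T] (fun t => potential k (s' t)).
  move=> ms; apply: measurable_funD => //; apply: measurable_funM => //.
  exact: measurable_funX.
have first_hit (w : n.-tuple T -> bool) (s : n.-tuple T -> R) k : (0 < k)%N ->
    measurable_fun [set: n.-tuple T] w -> measurable_fun [set: n.-tuple T] s ->
    iid_law P n [set t | w t && (lam * k%:R <= `|s t|)%R] <=
    \int[iid_law P n]_t (if w t && (lam * k%:R <= `|s t|)%R
                         then potential k (s t) else 0)%:E.
  move=> k0 mw ms; set A := [set t | _].
  have mA : measurable A.
    apply: measurable_bool_set; apply: measurable_and => //.
    by apply: measurable_fun_ler => //; exact: measurableT_comp.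
  rewrite -[X in iid_law P n X]setIT -integral_indic//.
  apply: ge0_integral_mono => t; rewrite ?lee_fin// indicE.
  have [|tA] := boolP (t \in A).
    by rewrite inE /A /= => wt; rewrite wt potential_ge1//; case/andP: wt.
  by case: ifP.
elim: l => [_ w s k k0 mw ms _ _ | i l IH /= /andP[il ul] w s k k0 mw ms winv sinv].
  rewrite /=; under eq_set do rewrite orbF.
  apply: (le_trans (first_hit _ _ _ k0 mw ms)).
  apply: ge0_integral_mono => t; rewrite lee_fin; first by case: ifP.
  by case: (w t) => //=; case: ifP.
pose c t := (lam * k%:R <= `|s t|)%R.
have mc : measurable_fun [set: n.-tuple T] c.
  by apply: measurable_fun_ler => //; exact: measurableT_comp.
pose w' t := w t && ~~ c t.
have mw' : measurable_fun [set: n.-tuple T] w'.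
  by apply: measurable_and => //; exact: measurable_neg.
pose s' t := (s t + psi (tnth t i))%R.
have ms' : measurable_fun [set: n.-tuple T] s' by exact: measurable_funD.
have w'inv j t z : j \in i :: l -> w' (set_coord t j z) = w' t.
  by move=> jl; rewrite /w' /c winv ?sinv.
have s'inv j t z : j \in l -> s' (set_coord t j z) = s' t.
  move=> jl; rewrite /s' sinv ?inE ?jl ?orbT// tnth_set_coord.
  by case: eqP => // ij; rewrite ij jl in il.
have {}IH := IH ul w' s' k.+1 isT mw' ms'
  (fun j t z jl => w'inv j t z (mem_behead (s := i :: l) jl)) s'inv.
apply: (@le_trans _ _ (iid_law P n [set t | w t && c t] +
                       iid_law P n [set t | w' t && hits (s' t) k.+1 l t])).
  apply: le_trans (measureU2 _ _ _); last 2 first.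
  - by apply: measurable_bool_set; exact: measurable_and.
  - apply: measurable_bool_set; apply: measurable_and => //.
    exact: measurable_hits.
  apply: iid_law_mono => t /=; rewrite /w' -/(c t) -/(s' t).
  by case: (w t) => //=; case: (c t) => //=; [left|right].
apply: (@le_trans _ _ (
  \int[iid_law P n]_t (if w t && c t then potential k (s t) else 0)%:E +
  \int[iid_law P n]_t (if w' t then potential k (s t) else 0)%:E)).
  apply: leeD; first exact: first_hit.
  apply: (le_trans IH).
  rewrite (integral_iid_resample _ i)//; last 2 first.
  - apply/measurable_EFinP; apply: measurable_fun_ifT => //; exact: mpot.
  - by move=> t; rewrite lee_fin; case: ifP.
  apply: ge0_integral_mono => t.
    by apply: integral_ge0 => z _; rewrite lee_fin; case: ifP.
  under eq_integral do rewrite w'inv ?mem_head//.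
  case: (w' t); last by rewrite integral_probability_cst.
  under eq_integral do rewrite /s' sinv ?mem_head// tnth_set_coord eqxx.
  exact: potential_step.
rewrite -ge0_integralD//; last 4 first.
- by move=> t _; rewrite lee_fin; case: ifP.
- apply/measurable_EFinP; apply: measurable_fun_ifT => //; last exact: mpot.
  exact: measurable_and.
- by move=> t _; rewrite lee_fin; case: ifP.
- by apply/measurable_EFinP; apply: measurable_fun_ifT => //; exact: mpot.
apply: ge0_integral_mono => t.
  by rewrite -EFinD lee_fin; apply: addr_ge0; case: ifP.
rewrite -EFinD lee_fin /w'.
by case: (w t); case: (c t); rewrite /= ?addr0 ?add0r.
Qed.

Lemma hitsP l (s : R) k t j : (j <= size l)%N ->
  (lam * (k + j)%:R <= `|s + \sum_(i <- take j l) psi (tnth t i)|)%R ->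
  hits s k l t.
Proof.
elim: l s k j => [|i l IH] s k [|j] //= jl; rewrite ?addn0 ?big_nil ?addr0.
- by move=> ->.
- by move=> ->.
rewrite big_cons addrA addnS -addSn => H; apply/orP; right; exact: IH H.
Qed.

(** The Hajek-Renyi inequality for S_j / j with j >= N. The potential is used from
    time N on, started at S_N, whose second moment is N v; this produces the
    factor 2. *)
Lemma iid_maximal_inequality l N : uniq l -> (0 < N)%N ->
  iid_law P n [set t | exists2 j, (N <= j <= size l)%N &
      (lam * j%:R <= `|\sum_(i <- take j l) psi (tnth t i)|)%R] <=
  (2 * v / (N%:R * lam ^+ 2))%:E.
Proof.
move=> ul N0.
have rhs0 : (0 <= 2 * v / (N%:R * lam ^+ 2))%R.
  by rewrite divr_ge0// mulr_ge0// sqr_ge0.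
have [Nl|lN] := leqP N (size l); last first.
  rewrite (_ : [set t | _] = set0) ?measure0 ?lee_fin//.
  apply/seteqP; split=> // t [j /andP[Nj jl] _].
  by have := leq_trans lN (leq_trans Nj jl); rewrite ltnn.
pose l1 := take N l; pose l2 := drop N l.
have ul1 : uniq l1 by exact: take_uniq.
have ul2 : uniq l2 by exact: drop_uniq.
have sl1 : size l1 = N by rewrite size_takel.
pose s t := (\sum_(i <- l1) psi (tnth t i))%R.
have ms : measurable_fun [set: n.-tuple T] s by exact: measurable_sum.
have sinv i t z : i \in l2 -> s (set_coord t i z) = s t.
  move=> il2; apply: eq_big_seq => j jl1; rewrite tnth_set_coord; case: eqP => // ji.
  move: ul; rewrite -(cat_take_drop N l) cat_uniq => /and3P[_ /hasPn/(_ i il2)].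
  by rewrite -ji /= jl1.
apply: le_trans (_ : iid_law P n [set t | true && hits (s t) N l2 t] <= _).
  apply: iid_law_mono => t [j /andP[Nj jl]] /= H.
  apply: (@hitsP _ _ _ _ (j - N)); first by rewrite size_drop leq_sub2r.
  rewrite subnKC// /s -big_cat/= (_ : l1 ++ _ = take j l)//.
  by rewrite -[in RHS](subnKC Nj) takeD.
apply: (le_trans (hits_potential ul2 N0 _ ms _ sinv)) => //.
rewrite /=.
under eq_integral do rewrite /potential EFinD EFinM.
have h0 : (0 <= (lam * N%:R) ^- 2)%R by rewrite invr_ge0 sqr_ge0.
have m2 : measurable_fun [set: n.-tuple T] (fun t => (s t ^+ 2)%:E).
  exact/measurable_EFinP/measurable_funX.
rewrite ge0_integralD//; last 3 first.
- by move=> t _; rewrite -EFinM lee_fin mulr_ge0// sqr_ge0.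
- exact: measurable_funeM.
- by move=> t _; rewrite lee_fin divr_ge0// mulr_ge0// sqr_ge0.
rewrite ge0_integralZl_EFin//; last by move=> t _; rewrite lee_fin sqr_ge0.
rewrite iid_second_moment// integral_probability_cst sl1 -EFinM -EFinD lee_fin.
by rewrite le_eqVlt; apply/orP; left; apply/eqP; field; rewrite !gt_eqF// ltr0n.
Qed.

End maximal_inequality.

(** * Slopes of the greatest convex minorant *)

Section greatest_convex_minorant.
Context (R : realType) (n : nat).
Variables y x : n.-tuple (measurableTypeR R).
Hypothesis n_gt0 : (0 < n)%N.

Definition psum (k : nat) : R := \sum_(0 <= i < k) ordY y x i.+1.

(** The length of the part of the i-th unit cell that lies below k + theta. *)
Let cell_length (i k : nat) (theta : R) : 0 <= theta <= 1 ->
  lebesgue_measure (`]i%:R, i.+1%:R] `&` `[0, (k%:R + theta : R)])%classic =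
  (if (i < k)%N then 1 else if i == k then theta else 0)%:E.
Proof.
move=> /andP[th0 th1]; case: (ltngtP i k) => [ik|ki|->].
- rewrite (_ : _ `&` _ = `]i%:R, i.+1%:R]%classic).
    rewrite lebesgue_measure_itv/= lte_fin ltr_nat ltnSn -EFinB.
    by rewrite -natrB// subSnn.
  apply/seteqP; split => [s []//|s /=]; rewrite !in_itv/= => /andP[is1 si].
  split; first by rewrite is1.
  rewrite (le_trans _ (ltW is1))//= (le_trans si)// ler_wpDr//.
  by rewrite ler_nat.
- rewrite (_ : _ `&` _ = set0) ?measure0//.
  apply/seteqP; split => // s []/=; rewrite !in_itv/= => /andP[is1 _] /andP[_].
  rewrite leNgt => /negP; apply; apply: le_lt_trans is1.
  by rewrite (le_trans (lerD (lexx _) th1))// natr1 ler_nat.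
- rewrite (_ : _ `&` _ = `]k%:R, (k%:R + theta)]%classic).
    rewrite lebesgue_measure_itv/= lte_fin ltrDl.
    case: ltP => [_|th0']; first by rewrite -EFinB addrAC subrr add0r.
    by congr EFin; apply/eqP; rewrite eq_le th0 th0'.
  apply/seteqP; split => [s []/=|s /=]; rewrite !in_itv/=.
    by move=> /andP[-> _] /andP[_ ->].
  move=> /andP[ks sk]; rewrite ks sk (le_trans _ (ltW ks))//; split => //=.
  by rewrite (le_trans sk)// -natr1 lerD2l.
Qed.

Lemma cusum_affine k (theta : R) : (k < n)%N -> 0 <= theta <= 1 ->
  cusum y x (k%:R + theta) = psum k + theta * ordY y x k.+1.
Proof.
move=> kn th; rewrite /cusum /Rintegral /step_h.
under eq_integral do rewrite big_add1 -sumEFin /=.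
set D := `[0, _]%classic.
have mD : measurable D by exact: measurable_itv.
have i0 (i : nat) : lebesgue_measure.-integrable D
    (fun s : R => (\1_(`]i%:R, i.+1%:R]%classic) s)%:E).
  apply: (@integrableS _ _ _ _ setT) => //; exact: integrable_indic_itv.
have iI (i : nat) : lebesgue_measure.-integrable D
    (fun s : R => (ordY y x i.+1 * \1_(`]i%:R, i.+1%:R]%classic) s)%:E).
  by under eq_fun do rewrite EFinM; exact: integrableZl.
have term (i : nat) : (\int[lebesgue_measure]_(s in D)
    (ordY y x i.+1 * \1_(`]i%:R, i.+1%:R]%classic) s)%:E =
    (ordY y x i.+1 * (if (i < k)%N then 1 else if i == k then theta else 0))%:E)%E.
  under eq_integral do rewrite EFinM.
  rewrite integralZl// integral_indic// EFinM; congr (_ * _)%E.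
  exact: cell_length.
rewrite integral_sum// (eq_bigr _ (fun i _ => term i)).
rewrite sumEFin /=.
rewrite (big_cat_nat (n := k))//=; last exact: ltnW.
rewrite [X in _ + X]big_ltn// ltnn eqxx [X in _ + (_ + X)]big1_seq ?addr0; last first.
  move=> i /=; rewrite mem_index_iota => /andP[ki _].
  by rewrite ltnNge (ltnW ki)/= gtn_eqF// mulr0.
rewrite [theta * _]mulrC; congr (_ + _); rewrite /psum.
by apply: eq_big_nat => i /= ->; rewrite mulr1.
Qed.

Lemma cusum_knot k : (k <= n)%N -> cusum y x k%:R = psum k.
Proof.
case: k => [|k] kn.
  by have := @cusum_affine 0 0 n_gt0; rewrite lexx ler01 addr0 mul0r addr0; exact.
have := @cusum_affine k 1 kn; rewrite ler01 lexx natr1 mul1r => ->//.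
by rewrite /psum big_nat_recr.
Qed.

Let minorant (a b : R) :=
  forall s : R, 0 <= s <= n%:R -> a * s + b <= cusum y x s.

(** Between consecutive integers the cumulative sum diagram is affine, so an
    affine function lies below it as soon as it does at the integers. *)
Let minorant_of_knots (a b : R) :
  (forall k, (k <= n)%N -> a * k%:R + b <= psum k) -> minorant a b.
Proof.
move=> ab s /andP[s0 sn].
have [k [kn ks sk]] : exists k, [/\ (k < n)%N, k%:R <= s & s <= k.+1%:R].
  have [->|sn'] := eqVneq s n%:R.
    by exists n.-1; rewrite prednK// ler_nat leq_pred.
  have /andP[ts st] := truncn_itv s0.
  exists (Num.truncn s); split => //; last exact: ltW.
  by rewrite -(ltr_nat R) (le_lt_trans ts)// lt_neqAle sn'.
have := @cusum_affine k (s - k%:R) kn.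
rewrite subr_ge0 ks lerBlDl natr1 sk addrC subrK => ->//.
have h0 := ab _ (ltnW kn); have h1 := ab _ kn.
rewrite [psum k.+1]big_nat_recr//= -/(psum k) -natr1 in h1.
have -> : a * s + b = (1 - (s - k%:R)) * (a * k%:R + b) +
                      (s - k%:R) * (a * (k%:R + 1) + b) by ring.
have -> : psum k + (s - k%:R) * ordY y x k.+1 = (1 - (s - k%:R)) * psum k +
                      (s - k%:R) * (psum k + ordY y x k.+1) by ring.
by apply: lerD; apply: ler_wpM2l => //; rewrite -natr1 in sk; lra.
Qed.

Let minorant_knot a b k : minorant a b -> (k <= n)%N ->
  a * k%:R + b <= psum k.
Proof. by move=> ab kn; rewrite -cusum_knot//; apply: ab; rewrite ler0n ler_nat. Qed.

Let exists_minorant : exists a b, minorant a b.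
Proof.
exists 0, (- \sum_(0 <= i < n) `|ordY y x i.+1|); apply: minorant_of_knots => k kn.
rewrite mul0r add0r lerNl; apply: (le_trans (ler_norm _)).
rewrite normrN; apply: (le_trans (ler_norm_sum _ _ _)).
by rewrite [leRHS](big_cat_nat (n := k))//= lerDl; apply: sumr_ge0.
Qed.

Let le_gcm (a b s : R) : 0 <= s <= n%:R -> minorant a b -> a * s + b <= gcm y x s.
Proof.
move=> s0n ab; apply: ub_le_sup; last by exists a, b.
by exists (cusum y x s) => _ [a' [b' [-> ab']]]; exact: ab'.
Qed.

Let gcm_le (s z : R) : (forall a b, minorant a b -> a * s + b <= z) -> gcm y x s <= z.
Proof.
move=> H; apply: ge_sup.
  by have [a [b ab]] := exists_minorant; exists (a * s + b), a, b.
by move=> _ [a [b [-> ab]]]; exact: H.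
Qed.

(** If an affine minorant of the diagram is steeper than A, rotate it about m until
    its slope is A. It goes down on the right of m, and on the left of m it stays
    below the line of slope A through the point of abscissa t0 of the diagram,
    which lies below the diagram there by the assumption on A. *)
Let gcm_sub_le m t0 (A h : R) : (m <= t0 <= n)%N -> 0 <= h <= 1 -> (0 < m)%N ->
  (forall k, (k < m)%N -> psum t0 - psum k <= A * (t0%:R - k%:R)) ->
  gcm y x m%:R <= gcm y x (m%:R - h) + A * h.
Proof.
move=> /andP[mt tn] /andP[h0 h1] m0 HA; apply: gcm_le => a b ab.
have mhn : 0 <= m%:R - h <= n%:R.
  rewrite subr_ge0 (le_trans h1) ?ler1n//= lerBlDr ler_wpDr//.
  by rewrite ler_nat (leq_trans mt).
have [aA|Aa] := leP a A.
  have := le_gcm mhn ab; have := ler_wpM2r h0 aA.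
  rewrite -[a * _ + b](addrK (a * h)); nra.
have /(le_gcm mhn) : minorant A ((a - A) * m%:R + b); last first.
  by move=> ?; lra.
apply: minorant_of_knots => k kn.
have [km|mk] := ltnP k m; last first.
  have := minorant_knot ab kn; have : m%:R <= k%:R :> R by rewrite ler_nat.
  by move: Aa => {HA} ? ? ?; nra.
have := minorant_knot ab tn; have := HA _ km.
have : m%:R <= t0%:R :> R by rewrite ler_nat.
by move=> {HA} ? ? ?; nra.
Qed.

(** If an affine minorant is flatter than B, rotate it about m - h until its slope is
    B. It goes down on the left of m - h, and from m on it stays below the line of
    slope B through the point of abscissa k0 of the diagram, which lies below the
    diagram there by the assumption on B. *)
Let gcm_sub_ge m k0 (B h : R) : (k0 < m)%N -> (m <= n)%N -> 0 <= h <= 1 ->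
  (forall t, (m <= t <= n)%N -> B * (t%:R - k0%:R) <= psum t - psum k0) ->
  gcm y x (m%:R - h) <= gcm y x m%:R - B * h.
Proof.
move=> km mn /andP[h0 h1] HB; apply: gcm_le => a b ab.
have m0n : 0 <= (m%:R : R) <= n%:R by rewrite ler0n ler_nat.
have [Ba|aB] := leP B a.
  have := le_gcm m0n ab; have := ler_wpM2r h0 Ba; lra.
have /(le_gcm m0n) : minorant B ((a - B) * (m%:R - h) + b); last by lra.
apply: minorant_of_knots => k kn.
have [km'|mk] := ltnP k m.
  have := minorant_knot ab kn.
  have : k%:R + 1 <= m%:R :> R by rewrite natr1 ler_nat.
  by move=> {HB} ? ?; nra.
have := minorant_knot ab (leq_trans (ltnW km) mn).
have /HB : (m <= k <= n)%N by rewrite mk.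
have : k0%:R + 1 <= m%:R :> R by rewrite natr1 ler_nat.
by move=> {HB} ? ? ?; nra.
Qed.

(** The minorant is convex, as a supremum of affine functions; hence the left
    difference quotients converge. *)
Let gcm_quotient_mono m (h h' : R) : (0 < m <= n)%N -> 0 < h -> h <= h' -> h' <= 1 ->
  (gcm y x m%:R - gcm y x (m%:R - h')) / h' <=
  (gcm y x m%:R - gcm y x (m%:R - h)) / h.
Proof.
move=> /andP[m0 mn] h0 hh' h'1.
have h'0 : 0 < h' by exact: lt_le_trans hh'.
have in0n (u : R) : 0 <= u <= 1 -> 0 <= m%:R - u <= n%:R.
  move=> /andP[u0 u1]; rewrite subr_ge0 (le_trans u1) ?ler1n//=.
  by rewrite lerBlDr ler_wpDr// ler_nat.
suff conv : gcm y x (m%:R - h) <=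
    h / h' * gcm y x (m%:R - h') + (1 - h / h') * gcm y x m%:R.
  rewrite ler_pdivlMr//; move: conv; set p := h / h'.
  rewrite (_ : _ / h' * h = p * (gcm y x m%:R - gcm y x (m%:R - h'))); first lra.
  by rewrite /p; field; rewrite gt_eqF.
have p0 : 0 <= h / h' by rewrite divr_ge0// ltW.
have p1 : h / h' <= 1 by rewrite ler_pdivrMr// mul1r.
apply: gcm_le => a b ab.
have -> : a * (m%:R - h) + b = h / h' * (a * (m%:R - h') + b) +
    (1 - h / h') * (a * m%:R + b) by field; rewrite gt_eqF.
apply: lerD; apply: ler_wpM2l => //; rewrite ?subr_ge0//; apply: le_gcm => //.
  by apply: in0n; rewrite h'1 ltW.
by rewrite ler0n ler_nat.
Qed.

(** The two halves of the max-min formula: A bounds the averages over k+1, ..., t0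
    for all k < m, and B those over k0+1, ..., t for all t >= m. *)
Lemma gcm_slope_bounds m t0 k0 (A B : R) : (m <= t0 <= n)%N -> (k0 < m)%N ->
  (forall k, (k < m)%N -> psum t0 - psum k <= A * (t0%:R - k%:R)) ->
  (forall t, (m <= t <= n)%N -> B * (t%:R - k0%:R) <= psum t - psum k0) ->
  B <= gcm_slope y x m%:R <= A.
Proof.
move=> mtn km HA HB.
have m0 : (0 < m)%N by exact: leq_ltn_trans km.
have mn : (m <= n)%N by case/andP: mtn => /leq_trans h /h.
pose q (h : R) := (gcm y x m%:R - gcm y x (m%:R - h)) / h.
have qA (h : R) : 0 < h < 1 -> q h <= A.
  move=> /andP[h0 h1]; rewrite /q ler_pdivrMr// lerBlDl.
  by apply: gcm_sub_le mtn _ m0 HA; rewrite !ltW.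
have qB (h : R) : 0 < h < 1 -> B <= q h.
  move=> /andP[h0 h1]; rewrite /q ler_pdivlMr// lerBrDl -lerBrDr.
  by apply: gcm_sub_ge km mn _ HB; rewrite !ltW.
have near01 : \forall h \near (0 : R)^'+, 0 < h < 1.
  near=> h; apply/andP; split; first by near: h; exact: nbhs_right_gt.
  by near: h; exact: nbhs_right_lt.
have qcvg : cvg (q h @[h --> 0^'+]).
  apply/cvg_ex; eexists.
  apply: (@nonincreasing_at_right_cvgr _ q 0 (BLeft 1)); first by rewrite bnd_simp.
    move=> h h'; rewrite !in_itv/= => /andP[h0 h1] /andP[h'0 h'1] hh'.
    have m0n : (0 < m <= n)%N by rewrite m0.
    exact: gcm_quotient_mono m0n h0 hh' (ltW h'1).
  by exists A => z [h /=]; rewrite in_itv/= => h01 <-; exact: qA.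
apply/andP; split.
  by apply: (limr_ge qcvg); apply: filterS near01 => h; exact: qB.
by apply: (limr_le qcvg); apply: filterS near01 => h; exact: qA.
Unshelve. all: by end_near. Qed.

End greatest_convex_minorant.

(** * The estimator in terms of ranked observations *)

Lemma sorted_prefix (T : eqType) (r : rel T) (a : pred T) (s : seq T) :
  transitive r -> (forall i j, r i j -> a j -> a i) -> sorted r s ->
  all a (take (count a s) s) && all (predC a) (drop (count a s) s).
Proof.
move=> r_tr ra; elim: s => [//|i s IH] /= ps.
have [ai|nai] := boolP (a i); first by rewrite add1n /= ai IH ?(path_sorted ps).
have na : all (predC a) s.
  apply/allP => j js; apply: contra nai => aj.
  by apply: (ra _ j) => //; exact: (allP (order_path_min r_tr ps)).
rewrite add0n; have -> : count a s = 0%N.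
  by apply/eqP; rewrite -leqn0 leqNgt -has_count -all_predC.
by rewrite /= nai na.
Qed.

Lemma count_splitI (T : Type) (a b : pred T) (s : seq T) :
  count a s = (count (fun i => a i && b i) s + count (fun i => a i && ~~ b i) s)%N.
Proof.
elim: s => //= i s ->.
by case: (a i); case: (b i) => /=; rewrite ?addn0 ?add0n// addnCA.
Qed.

Section order_statistics.
Context (R : realType) (n : nat).
Implicit Types y x e : n.-tuple (measurableTypeR R).

(** The ranking depends on x only, so it is fixed once the design is given. *)
Definition rank_order x : seq 'I_n :=
  sort (relpre (tnth x) (fun u v : R => u <= v)) (enum 'I_n).

Lemma perm_rank_order x : perm_eq (rank_order x) (enum 'I_n).
Proof. by rewrite perm_sort. Qed.

Lemma size_rank_order x : size (rank_order x) = n.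
Proof. by rewrite size_sort size_enum_ord. Qed.

Lemma uniq_rank_order x : uniq (rank_order x).
Proof. by rewrite sort_uniq enum_uniq. Qed.

Lemma sorted_obsE y x :
  sorted_obs y x = [seq (tnth x i, tnth y i) | i <- rank_order x].
Proof.
rewrite /sorted_obs -{1}(map_tnth_enum x) -{1}(map_tnth_enum y) zip_map.
by rewrite sort_map.
Qed.

Lemma ordXE y x i0 p : (p < n)%N ->
  ordX y x p.+1 = tnth x (nth i0 (rank_order x) p).
Proof.
by move=> pn; rewrite /ordX sorted_obsE (nth_map i0) ?size_rank_order.
Qed.

Lemma psumE y x k : (k <= n)%N ->
  psum y x k = \sum_(i <- take k (rank_order x)) tnth y i.
Proof.
case: k => [_|k kn]; first by rewrite take0 big_nil /psum big_geq.
have i0 : 'I_n by exact: Ordinal kn.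
rewrite (big_nth i0) size_takel ?size_sort ?size_enum_ord// /psum.
apply: eq_big_nat => i /= ik.
rewrite /ordY sorted_obsE (nth_map i0) ?nth_take//.
by rewrite size_sort size_enum_ord (leq_trans ik).
Qed.

Lemma psumB y x k t : (k <= t <= n)%N ->
  psum y x t - psum y x k = \sum_(i <- drop k (take t (rank_order x))) tnth y i.
Proof.
move=> /andP[kt tn]; rewrite !psumE//; last exact: leq_trans tn.
rewrite -[in X in X - _](cat_take_drop k (take t _)) big_cat/= take_takel//.
by rewrite addrAC subrr add0r.
Qed.

Definition npoints x (a : pred R) := count (fun i => a (tnth x i)) (enum 'I_n).

Lemma npoints_rank_order x (a : pred R) :
  (forall u v, u <= v -> a v -> a u) ->
  all (fun i => a (tnth x i)) (take (npoints x a) (rank_order x)) &&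
  all (fun i => ~~ a (tnth x i)) (drop (npoints x a) (rank_order x)).
Proof.
move=> ad; rewrite /npoints.
rewrite -(permP (perm_rank_order x)); apply: (@sorted_prefix _ (relpre (tnth x) (fun u v : R => u <= v))).
- by move=> j i k /=; exact: le_trans.
- by move=> i j /= ij; exact: ad.
- by apply: sort_sorted => i j; exact: le_total.
Qed.

Lemma npoints_le x a : (npoints x a <= n)%N.
Proof. by rewrite (leq_trans (count_size _ _))// size_enum_ord. Qed.

Lemma npointsB x (a b : pred R) : (forall u, b u -> a u) ->
  npoints x a = (npoints x b + npoints x (fun u => a u && ~~ b u))%N.
Proof.
move=> ba; rewrite /npoints (count_splitI _ (fun i => b (tnth x i))).
congr (_ + _)%N; apply: eq_count => i.
by have [/ba ->|] := boolP (b (tnth x i)); rewrite ?andbF.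
Qed.

Variables (y x e mu : n.-tuple (measurableTypeR R)).
Variables (delta lo up r : R) (N : nat).
Hypothesis y_def : forall i, tnth y i = tnth mu i + tnth e i.
Hypothesis delta_gt0 : 0 < delta.

(** Indices by decreasing rank from the last design point at most delta, and by
    increasing rank from the first one at least - delta. Blocks of ranks that
    end, respectively start, there are prefixes of these lists. *)
Definition right_order x delta : seq 'I_n :=
  rev (take (npoints x (fun u => u <= delta)) (rank_order x)).
Definition left_order x delta : seq 'I_n :=
  drop (npoints x (fun u => u < - delta)) (rank_order x).

Hypothesis mu_le : forall i, tnth x i <= delta -> tnth mu i <= up.
Hypothesis mu_ge : forall i, - delta <= tnth x i -> lo <= tnth mu i.
Hypothesis N_gt0 : (0 < N)%N.
Hypothesis N_right : (N <= npoints x (fun u => (0%R <= u <= delta)%R))%N.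
Hypothesis N_left : (N <= npoints x (fun u => (- delta <= u < 0)%R))%N.
Hypothesis right_gt1 : (1 < npoints x (fun u => (0%R <= u <= delta)%R))%N.
Hypothesis e_right : forall j, (N <= j <= size (right_order x delta))%N ->
  \sum_(i <- take j (right_order x delta)) tnth e i <= r * j%:R.
Hypothesis e_left : forall j, (N <= j <= size (left_order x delta))%N ->
  - (r * j%:R) <= \sum_(i <- take j (left_order x delta)) tnth e i.

Let o := rank_order x.
Let c0 := npoints x (fun u => u < 0).
Let t0 := npoints x (fun u => u <= delta).
Let k0 := npoints x (fun u => u < - delta).

Let t0E : t0 = (c0 + npoints x (fun u => (0%R <= u <= delta)%R))%N.
Proof.
rewrite /t0 (@npointsB x _ (fun u => u < 0)); last first.
  by move=> u u0; rewrite (le_trans (ltW u0))// ltW.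
by congr (_ + _)%N; apply: eq_count => i; rewrite -leNgt andbC.
Qed.

Let c0E : c0 = (k0 + npoints x (fun u => (- delta <= u < 0)%R))%N.
Proof.
rewrite /c0 (@npointsB x _ (fun u => u < - delta)); last first.
  by move=> u ud; rewrite (lt_trans ud)// oppr_lt0.
by congr (_ + _)%N; apply: eq_count => i; rewrite -leNgt andbC.
Qed.

Let t0n : (t0 <= n)%N. Proof. exact: npoints_le. Qed.

Let n_gt0 : (0 < n)%N.
Proof. by rewrite (leq_trans _ t0n)// t0E addn_gt0 (ltnW right_gt1) orbT. Qed.

Let sum_diff k t : (k <= t <= n)%N ->
  psum y x t - psum y x k = \sum_(i <- drop k (take t o)) tnth mu i +
                            \sum_(i <- drop k (take t o)) tnth e i.
Proof.
move=> ktn; rewrite psumB// -big_split/=.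
by apply: eq_bigr => i _; rewrite y_def.
Qed.

Let psum_right k : (k < c0.+1)%N ->
  psum y x t0 - psum y x k <= (up + r) * (t0%:R - k%:R).
Proof.
rewrite ltnS => kc; have kt : (k <= t0)%N by rewrite (leq_trans kc)// t0E leq_addr.
rewrite sum_diff ?kt// -natrB// mulrDl; apply: lerD.
  have -> : up * (t0 - k)%:R = \sum_(i <- drop k (take t0 o)) up.
    rewrite big_const_seq count_predT size_drop size_takel ?size_rank_order//.
    by rewrite iter_addr_0 mulr_natr.
  rewrite big_seq [leRHS]big_seq; apply: ler_sum => i /mem_drop it.
  apply: mu_le.
  have /andP[/allP/(_ _ it)//] := @npoints_rank_order x (fun u => u <= delta)
    (fun u v uv vd => le_trans uv vd).
have -> : \sum_(i <- drop k (take t0 o)) tnth e i =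
          \sum_(i <- take (t0 - k) (right_order x delta)) tnth e i.
  apply: perm_big; rewrite /right_order -/t0 -/o.
  by rewrite take_rev size_takel ?size_rank_order// subKn// perm_sym perm_rev.
apply: e_right; rewrite size_rev size_takel ?size_rank_order// leq_subr andbT.
by rewrite leq_subRL// (leq_trans _ (_ : c0 + N <= _)%N) ?leq_add2r// t0E leq_add2l.
Qed.

Let psum_left t : (c0 < t <= n)%N ->
  (lo - r) * (t%:R - k0%:R) <= psum y x t - psum y x k0.
Proof.
move=> /andP[ct tn]; have kt : (k0 + N <= t)%N.
  by rewrite (leq_trans _ (ltnW ct))// c0E leq_add2l.
have kt' : (k0 <= t)%N by rewrite (leq_trans _ kt)// leq_addr.
have dE : drop k0 (take t o) = take (t - k0) (left_order x delta).
  by rewrite /left_order -/k0 -/o take_drop subnK.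
rewrite sum_diff ?kt'// -natrB// mulrDl mulNr; apply: lerD; last first.
  rewrite dE; apply: e_left; rewrite leq_subRL// kt.
  by rewrite size_drop size_rank_order leq_sub2r.
have -> : lo * (t - k0)%:R = \sum_(i <- drop k0 (take t o)) lo.
  rewrite big_const_seq count_predT size_drop size_takel ?size_rank_order//.
  by rewrite iter_addr_0 mulr_natr.
rewrite dE big_seq [leRHS]big_seq; apply: ler_sum => i /mem_take it.
apply: mu_ge; rewrite leNgt.
have /andP[_ /allP/(_ _ it)//] := @npoints_rank_order x (fun u => u < - delta)
  (fun u v uv vd => le_lt_trans uv vd).
Qed.

Let ordX_lt0 p : (p < n)%N -> (ordX y x p.+1 < 0) = (p < c0)%N.
Proof.
move=> pn; rewrite (ordXE _ _ (Ordinal n_gt0))//.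
have /andP[/allP Ht /allP Hd] := @npoints_rank_order x (fun u => u < 0)
  (fun u v uv vd => le_lt_trans uv vd).
have [pc|cp] := ltnP p c0.
  apply: Ht; rewrite -(nth_take _ pc); apply: mem_nth.
  by rewrite size_takel// size_rank_order npoints_le.
apply/negbTE/Hd; rewrite -/c0 -(subnKC cp) -nth_drop; apply: mem_nth.
by rewrite size_drop size_rank_order ltn_sub2r// (leq_ltn_trans cp).
Qed.

(** In the max-min formula, a fixed right end at the last design point at most delta
    bounds the slope from above, and a fixed left end at the first one at
    least - delta bounds it from below. A block that contains the rank m of the first
    nonnegative design point has at least N elements. *)
Lemma lse_bounds : lo - r <= lse 0 (y, x) <= up + r.
Proof.
have c0_gt0 : (0 < c0)%N.
  by rewrite c0E addn_gt0 (leq_trans N_gt0 N_left) orbT.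
have c0n : (c0.+1 < n)%N.
  by rewrite (leq_trans _ t0n)// t0E -addn2 leq_add2l.
rewrite /lse; case: pickP => [m /andP[m1 /andP[Xl Xr]]|none].
  have m_gt0 : (0 < m)%N by exact: ltnW.
  have mE : m = c0.+1 :> nat.
    have m2n : (m.-2 < n)%N.
      by apply: leq_ltn_trans (ltn_ord m); rewrite -!subn1 -subnDA leq_subr.
    have m1E : m.-2.+1 = m.-1 by rewrite prednK// -subn1 subn_gt0.
    have m1n : (m.-1 < n)%N.
      by apply: leq_ltn_trans (ltn_ord m); exact: leq_pred.
    move: Xl; rewrite -m1E ordX_lt0// m1E => mc.
    move: Xr; rewrite leNgt -{1}(prednK m_gt0) ordX_lt0// -leqNgt => cm.
    by apply/eqP; rewrite -(prednK m_gt0) eqSS eqn_leq cm andbT mc.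
  rewrite mE; apply: (gcm_slope_bounds n_gt0 (t0 := t0) (k0 := k0)).
  - by rewrite t0n andbT t0E -addn1 leq_add2l (ltnW right_gt1).
  - by rewrite ltnS c0E leq_addr.
  - exact: psum_right.
  - exact: psum_left.
have := none (Ordinal c0n); rewrite /= ltnS c0_gt0/=.
rewrite -{1}(prednK c0_gt0) ordX_lt0 ?prednK// ?leqnn; last first.
  exact: ltnW (ltnW c0n).
by rewrite leNgt ordX_lt0 ?ltnn// (ltnW c0n).
Qed.

End order_statistics.

(** * Deviations of the estimator *)

Section iid_counts.
Local Open Scope ereal_scope.

Lemma sume_ord_const (R : realType) n (c : \bar R) : 0 <= c ->
  \sum_(i < n) c = n%:R%:E * c.
Proof.
move=> c0; elim: n => [|n IH]; first by rewrite big_ord0 mul0e.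
by rewrite big_ord_recr/= IH -natr1 EFinD ge0_muleDl ?lee_fin// mul1e.
Qed.

Context d (T : measurableType d) (R : realType) (P : probability T R).

Lemma integral_iid_sum n (h : T -> R) : measurable_fun [set: T] h ->
  (forall z, (0 <= h z)%R) ->
  \int[iid_law P n]_t (\sum_(i < n) h (tnth t i))%:E =
  n%:R%:E * \int[P]_z (h z)%:E.
Proof.
move=> mh h0.
have mhi i : measurable_fun [set: n.-tuple T] (fun t => (h (tnth t i))%:E).
  apply/measurable_EFinP; exact: measurableT_comp mh (measurable_tnth i).
under eq_integral do rewrite -sumEFin.
rewrite ge0_integral_sum//; last by move=> i t _; rewrite lee_fin.
under eq_bigr => i _.
  rewrite (integral_iid_resample _ i)//; last by move=> t; rewrite lee_fin.
  under eq_integral do under eq_integral do rewrite tnth_set_coord eqxx.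
  rewrite integral_probability_cst; over.
by rewrite sume_ord_const// integral_ge0// => z _; rewrite lee_fin.
Qed.

Lemma measurable_forall_tnth n (a : T -> bool) : measurable_fun [set: T] a ->
  measurable [set t : n.-tuple T | ~~ [forall i, a (tnth t i)]].
Proof.
move=> ma; rewrite (_ : [set t | _] =
    \bigcup_(i in [set: 'I_n]) [set t | ~~ a (tnth t i)]).
  apply: fin_bigcup_measurable => // i _.
  apply: measurable_bool_set; apply: measurable_neg.
  exact: measurableT_comp ma (measurable_tnth i).
apply/seteqP; split => t /=.
  by rewrite negb_forall => /existsP[i ai]; exists i.
by case=> i _ ai; rewrite negb_forall; apply/existsP; exists i.
Qed.

Lemma natr_count n (a : T -> bool) (t : n.-tuple T) :
  ((count (fun i => a (tnth t i)) (enum 'I_n))%:R =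
   \sum_(i <- enum 'I_n) \1_[set z | a z] (tnth t i) :> R)%R.
Proof.
rewrite -sum1_count natr_sum big_mkcond/=; apply: eq_bigr => i _; rewrite indicE.
have -> : (tnth t i \in [set z | a z]) = a (tnth t i).
  by apply/idP/idP; rewrite inE.
by case: (a _).
Qed.

Lemma measurable_count n (a : T -> bool) : measurable_fun [set: T] a ->
  measurable_fun [set: n.-tuple T]
    (fun t => (count (fun i => a (tnth t i)) (enum 'I_n))%:R : R).
Proof.
move=> ma; under eq_fun do rewrite natr_count.
apply: measurable_sum => i; apply: measurableT_comp (measurable_tnth i).
by apply: measurable_indic; exact: measurable_bool_set.
Qed.

Lemma iid_all n (a : T -> bool) : measurable_fun [set: T] a ->
  P [set z | a z] = 1 -> iid_law P n [set t | ~~ [forall i, a (tnth t i)]] = 0.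
Proof.
move=> ma Pa1.
have mA : measurable [set z | a z] by exact: measurable_bool_set.
have Pna : P [set z | ~~ a z] = 0.
  rewrite (_ : [set z | _] = ~` [set z | a z]); last first.
    by apply/seteqP; split => z /negP.
  by rewrite probability_setC// Pa1 subee.
have mna : measurable [set z | ~~ a z].
  by apply: measurable_bool_set; exact: measurable_neg.
have mB := @measurable_forall_tnth n a ma.
apply/eqP; rewrite eq_le measure_ge0 andbT.
have := integral_iid_sum n (h := \1_[set z | ~~ a z]) (measurable_indic mna) _.
have -> : \int[P]_z (\1_[set z | ~~ a z] z)%:E = 0.
  by rewrite integral_indic// setIT.
rewrite mule0 => <-//.
rewrite -[X in iid_law P n X]setIT -integral_indic//.
apply: ge0_integral_mono => t; rewrite lee_fin// indicE.
have [|_] := boolP (t \in _); last by rewrite sumr_ge0.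
rewrite inE /= negb_forall => /existsP[i ai].
rewrite (bigD1 i)//= -[leLHS]addr0 lerD ?sumr_ge0//.
by rewrite indicE mem_set.
Qed.

(** Chebyshev's inequality, which is the case N = n of the maximal inequality for
    the centred indicator. *)
Lemma iid_count_lower n (a : T -> bool) (p : R) : measurable_fun [set: T] a ->
  (0 < n)%N -> (0 < p)%R -> p%:E <= P [set z | a z] ->
  iid_law P n [set t | (count (fun i => a (tnth t i)) (enum 'I_n))%:R <
                       n%:R * p / 2]%R <= (8 / (n%:R * p))%:E.
Proof.
move=> ma n0 p0 pPa.
have mA : measurable [set z | a z] by exact: measurable_bool_set.
have fP : P [set z | a z] \is a fin_num by exact: fin_num_measure.
pose q := fine (P [set z | a z]).
have qE : q%:E = P [set z | a z] by rewrite fineK.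
have pq : (p <= q)%R by rewrite -lee_fin qE.
have q0 : (0 < q)%R by exact: lt_le_trans pq.
have ia : P.-integrable [set: T] (EFin \o \1_[set z | a z]) by exact: integrable_indic.
have eA : \int[P]_z (\1_[set z | a z] z)%:E = q%:E.
  by rewrite integral_indic// setIT.
have ic c : P.-integrable [set: T] (EFin \o cst c) by exact: finite_measure_integrable_cst.
pose psi z : R := (\1_[set z | a z] z - q)%R.
have psi_int : P.-integrable [set: T] (EFin \o psi) by exact: (integrableB measurableT ia (ic q)).
have psi_mean : \int[P]_z (psi z)%:E = 0.
  apply: etrans (integralB_EFin measurableT ia (ic q)) _.
  by rewrite eA (integral_probability_cst P q%:E : \int[P]_z (cst q z)%:E = _) subee.
have psi_var : \int[P]_z (psi z ^+ 2)%:E = (q * (1 - q))%:E.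
  rewrite (eq_integral (fun z => (1 - 2 * q)%:E * (\1_[set z | a z] z)%:E + (q ^+ 2)%:E)).
    rewrite (integralD measurableT (integrableZl measurableT _ ia))//; last exact: ic.
    rewrite (integralZl measurableT ia) eA integral_probability_cst.
    by rewrite -EFinM -EFinD; congr EFin; ring.
  move=> z _; rewrite -EFinM -EFinD /psi indicE; congr EFin.
  by case: (_ \in _) => /=; ring.
have lam0 : (0 < q / 2)%R by rewrite divr_gt0.
have := iid_maximal_inequality psi_int psi_mean psi_var lam0 (enum_uniq 'I_n) n0.
set B := [set t | exists2 j, _ & _] => HB.
apply: (@le_trans _ _ (iid_law P n B)).
  apply: iid_law_mono => t /= lt_count; exists n; first by rewrite leqnn size_enum_ord/=.
  have -> : take n (enum 'I_n) = enum 'I_n by rewrite take_oversize// size_enum_ord.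
  have -> : (\sum_(i <- enum 'I_n) psi (tnth t i) =
            (count (fun i => a (tnth t i)) (enum 'I_n))%:R - n%:R * q)%R.
    rewrite /psi sumrB big_const_seq count_predT size_enum_ord iter_addr_0 mulr_natl.
    by rewrite natr_count.
  have n0' : (0 < n%:R :> R)%R by rewrite ltr0n.
  have npq : (n%:R * p <= n%:R * q)%R by rewrite ler_pM2l.
  by rewrite ler_normr; apply/orP; right; lra.
apply: (le_trans HB); rewrite lee_fin.
have n0' : (0 < n%:R :> R)%R by rewrite ltr0n.
rewrite ler_pdivrMr ?mulr_gt0// ?exprn_gt0//.
have -> : (8 / (n%:R * p) * (n%:R * (q / 2) ^+ 2) = 2 * q * (q / p))%R.
  by field; rewrite !gt_eqF.
have : (1 <= q / p)%R by rewrite ler_pdivlMr// mul1r.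
by nra.
Qed.

End iid_counts.

Section deviation.
Context (R : realType).
Local Notation TR := (measurableTypeR R).
Variables (G : cumulativeBounded (0 : R) (1 : R)) (Q : probability TR R) (v : R).
Hypothesis Q_int : Q.-integrable [set: R] (EFin \o idfun).
Hypothesis Q_mean : (\int[Q]_z z%:E = 0)%E.
Hypothesis Q_sqr : (\int[Q]_z (z ^+ 2)%:E = v%:E)%E.
Hypothesis G_supp : law_of_cdf G `[-1, 1]%classic = 1%E.
Variables (n : nat) (f : R -> R) (delta w r gam : R).
Hypothesis f_nd : nondecreasing_on_itv f.
Hypothesis delta01 : 0 < delta <= 1.
Hypothesis f_right : f delta <= f 0 + w.
Hypothesis f_left : f 0 - w <= f (- delta).
Hypothesis r_gt0 : 0 < r.
Hypothesis gam_gt : w + r < gam.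

Let v_ge0 : 0 <= v.
Proof.
by rewrite -lee_fin -Q_sqr; apply: integral_ge0 => z _; rewrite lee_fin sqr_ge0.
Qed.

(** Given the design x, a large error of the estimator forces a large average of
    errors along one of the two orderings. *)
Lemma conditional_deviation (x : n.-tuple TR) (K : R) : 2 <= K ->
  [forall i, tnth x i \in `[(-1 : R), 1]] ->
  K <= (npoints x (fun u => (0%R <= u <= delta)%R))%:R ->
  K <= (npoints x (fun u => (- delta <= u < 0)%R))%:R ->
  (iid_law Q n [set e | (gam <= `|lse 0 (observe f (x, e)) - f 0|)%R] <=
    (4 * v / (K * r ^+ 2))%:E)%E.
Proof.
move=> K2 /forallP x11 KR KL; case/andP: delta01 => d0 d1.
set NR := npoints _ _ in KR; set NL := npoints _ _ in KL.
pose N := minn NR NL.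
have KN : K <= N%:R by rewrite /N /minn; case: ifP.
have N0 : (0 < N)%N by rewrite -(ltr_nat R) (lt_le_trans _ KN)// (lt_le_trans _ K2).
have NR1 : (1 < NR)%N by rewrite -(ltr_nat R) (lt_le_trans _ KR)// (lt_le_trans _ K2)// ltr_nat.
pose exceed (l : seq 'I_n) : set (n.-tuple TR) :=
  [set e | exists2 j, (N <= j <= size l)%N &
     r * j%:R <= `|\sum_(i <- take j l) tnth e i|].
have m_exceed l : measurable (exceed l).
  apply: bigcup_measurable => j _; apply: measurable_bool_set.
  apply: measurable_fun_ler => //; apply: measurableT_comp => //.
  by apply: measurable_sum => i; exact: measurable_tnth.
have P_exceed l : uniq l ->
    (iid_law Q n (exceed l) <= (2 * v / (K * r ^+ 2))%:E)%E.
  move=> ul; have := iid_maximal_inequality (n := n) Q_int Q_mean Q_sqr r_gt0 ul N0.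
  move=> /le_trans; apply; rewrite lee_fin.
  have K0 : 0 < K by rewrite (lt_le_trans _ K2).
  apply: ler_wpM2l; first by rewrite mulr_ge0.
  rewrite lef_pV2 ?posrE ?mulr_gt0 ?exprn_gt0 ?ltr0n//.
  by apply: ler_wpM2r; rewrite ?sqr_ge0.
apply: (@le_trans _ _ (iid_law Q n (exceed (right_order x delta) `|`
                                    exceed (left_order x delta)))).
  apply: iid_law_mono => e gam_le; apply: contrapT => /= /not_orP[nR nL].
  have {}gam_le : gam <= `|lse 0 (observe f (x, e)) - f 0| by exact: gam_le.
  have mem11 u : u \in `[(-1 : R), 1] -> (f \_ `[-1, 1]) u = f u.
    by move=> u11; rewrite patchE mem_set.
  have ind : delta \in `[-1, 1] by rewrite in_itv/= d1 andbT; lra.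
  have inNd : - delta \in `[-1, 1] by rewrite in_itv/=; lra.
  have /andP[H1 H2] : f (- delta) - r <= lse 0 (observe f (x, e)) <= f delta + r.
    apply: (@lse_bounds R n _ x e [tuple (f \_ `[-1, 1]) (tnth x i) | i < n]
      delta (f (- delta)) (f delta) r N) => //; rewrite ?geq_minl ?geq_minr//.
    - by move=> i; rewrite !tnth_mktuple.
    - by move=> i xid; rewrite tnth_mktuple mem11//; apply: f_nd.
    - by move=> i xid; rewrite tnth_mktuple mem11//; apply: f_nd.
    - move=> j jN; rewrite leNgt; apply/negP => lt; apply: nR; exists j => //.
      by rewrite (le_trans (ltW lt))// ler_norm.
    - move=> j jN; rewrite leNgt; apply/negP => lt; apply: nL; exists j => //.
      by rewrite ler_normr; apply/orP; right; rewrite lerNr ltW.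
  move: gam_le; rewrite leNgt => /negP; apply.
  by rewrite ltr_norml; apply/andP; split; move: gam_gt f_left f_right; lra.
apply: le_trans (measureU2 _ (m_exceed _) (m_exceed _)) _.
apply: le_trans (leeD (P_exceed _ _) (P_exceed _ _)) _.
- by rewrite rev_uniq take_uniq// uniq_rank_order.
- by rewrite drop_uniq// uniq_rank_order.
by rewrite -EFinD lee_fin -mulrDl (_ : 2 * v + 2 * v = 4 * v)//; ring.
Qed.

(** Both sides of 0 receive at least n p / 2 design points, except on an event of
    probability at most 16 / (n p); on its complement the conditional bound applies. *)
Lemma lse_deviation (p : R) : 0 < p -> 4 <= n%:R * p ->
  (p%:E <= law_of_cdf G [set u | (0 <= u <= delta)%R])%E ->
  (p%:E <= law_of_cdf G [set u | (- delta <= u < 0)%R])%E ->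
  (data_law G Q f [set yx : n.-tuple TR * n.-tuple TR |
                   (gam <= `|lse 0 yx - f 0|)%R]
   <= (16 / (n%:R * p) + 8 * v / (n%:R * p * r ^+ 2))%:E)%E.
Proof.
move=> p0 np4 pR pL.
have n0 : (0 < n)%N.
  by rewrite lt0n; apply/eqP => n0; move: np4; rewrite n0 mul0r; lra.
have n0' : 0 < n%:R :> R by rewrite ltr0n.
pose K := n%:R * p / 2.
have K2 : 2 <= K by rewrite /K; lra.
pose inside (u : TR) := - 1 <= u <= 1.
pose right (u : TR) := 0 <= u <= delta.
pose left (u : TR) := - delta <= u < 0.
have m_inside : measurable_fun [set: TR] inside.
  by apply: measurable_and; exact: measurable_fun_ler.
have m_right : measurable_fun [set: TR] right.
  by apply: measurable_and; exact: measurable_fun_ler.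
have m_left : measurable_fun [set: TR] left.
  by apply: measurable_and; [exact: measurable_fun_ler|exact: measurable_fun_ltr].
pose B1 : set (n.-tuple TR) := [set x | ~~ [forall i, inside (tnth x i)]].
pose B2 : set (n.-tuple TR) := [set x | (npoints x right)%:R < K].
pose B3 : set (n.-tuple TR) := [set x | (npoints x left)%:R < K].
have mB1 : measurable B1 by exact: measurable_forall_tnth.
have mB2 : measurable B2.
  apply: measurable_bool_set; apply: measurable_fun_ltr => //.
  exact: (@measurable_count _ _ R n _ m_right).
have mB3 : measurable B3.
  apply: measurable_bool_set; apply: measurable_fun_ltr => //.
  exact: (@measurable_count _ _ R n _ m_left).
have mB : measurable (B1 `|` B2 `|` B3) by apply: measurableU => //; exact: measurableU.
have PB : (iid_law (law_of_cdf G) n (B1 `|` B2 `|` B3) <= (16 / (n%:R * p))%:E)%E.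
  apply: le_trans (measureU2 _ (measurableU _ _ mB1 mB2) mB3) _.
  apply: le_trans (leeD (measureU2 _ mB1 mB2) (lexx _)) _.
  have PB1 : (iid_law (law_of_cdf G) n B1 <= 0)%E.
    rewrite /B1 iid_all//; rewrite -[RHS]G_supp; congr (law_of_cdf G _).
  have -> : 16 / (n%:R * p) = 8 / (n%:R * p) + 8 / (n%:R * p).
    by rewrite -mulrDl; congr (_ / _); ring.
  rewrite EFinD; apply: leeD; last exact: (iid_count_lower m_left n0 p0 pL).
  rewrite -[leRHS]add0e; apply: leeD; first exact: PB1.
  exact: (iid_count_lower m_right n0 p0 pR).
have C0 : 0 <= 4 * v / (K * r ^+ 2).
  have K0 : 0 < K by exact: lt_le_trans K2.
  by rewrite divr_ge0// mulr_ge0// ?sqr_ge0// ltW.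
rewrite /data_law /pushforward /product_measure1 /=.
apply: (@le_trans _ _ (\int[iid_law (law_of_cdf G) n]_x
    ((\1_(B1 `|` B2 `|` B3) x)%:E + (4 * v / (K * r ^+ 2))%:E))%E).
  apply: ge0_integral_mono => x /=; first exact: measure_ge0.
  have [|nB] := boolP (x \in B1 `|` B2 `|` B3).
    rewrite inE => xB; rewrite indicE mem_set//.
    apply: (@le_trans _ _ 1%E); last by rewrite leeDl ?lee_fin.
    by rewrite -(@probability_setT _ _ _ (iid_law Q n)); exact: iid_law_mono.
  rewrite indicE (negbTE nB) add0e.
  move: nB; rewrite notin_setE /= => /not_orP[/not_orP[nB1 nB2] nB3].
  apply: le_trans (conditional_deviation (x := x) K2 _ _ _).
  - by apply: iid_law_mono => e; rewrite /xsection /= inE.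
  - by move: nB1 => /negP; rewrite negbK.
  - by rewrite leNgt; apply/negP.
  - by rewrite leNgt; apply/negP.
rewrite ge0_integralD//; last first.
  by apply/measurable_EFinP; exact: measurable_indic.
rewrite integral_indic// setIT integral_probability_cst EFinD.
apply: leeD => //; rewrite lee_fin /K le_eqVlt; apply/orP; left; apply/eqP.
by field; rewrite !gt_eqF.
Qed.

End deviation.

(** * Hellinger affinity of shifted densities *)

Section density.
Local Open Scope ereal_scope.
Context (R : realType).
Local Notation TR := (measurableTypeR R).
Local Notation mu := (@lebesgue_measure R).

Lemma lebesgue_measure_translation (a : R) (A : set TR) : measurable A ->
  mu ((fun y => y + a)%R @^-1` A) = mu A.
Proof.
have ma : measurable_fun [set: TR] (fun y : TR => y + a : TR)%R.
  exact: measurable_funD.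
move=> mA; apply/esym.
pose nu : {measure set TR -> \bar R} :=
  measure_function_pushforward__canonical__measure_function_Measure mu ma.
apply: (lebesgue_measure_unique (mu := nu)) => // X.
move=> /ocitvP[->|[[b c] /= bc ->]].
  by rewrite !measure0.
rewrite [RHS](_ : _ = mu `](b - a)%R, (c - a)%R]%classic).
  rewrite !lebesgue_measure_itv/= !lte_fin ltrD2r bc -!EFinB; congr EFin.
  by rewrite opprB addrA subrK.
congr (mu _).
by apply/seteqP; split => y /=; rewrite !in_itv/= ltrBlDr lerBrDr.
Qed.

Lemma ge0_integral_translation (a : R) (F : R -> \bar R) :
  measurable_fun [set: TR] F -> (forall y, 0 <= F y) ->
  \int[mu]_y F (y + a)%R = \int[mu]_y F y.
Proof.
move=> mF F0.
have ma : measurable_fun [set: TR] (fun y : TR => y + a : TR)%R.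
  exact: measurable_funD.
have := ge0_integral_pushforward ma mu measurableT mF (fun y _ => F0 y).
rewrite preimage_setT => <-; apply: eq_measure_integral => A mA _.
exact: lebesgue_measure_translation.
Qed.

Import HBNNSimple.

(** By monotone convergence from simple functions. *)
Lemma ge0_integral_density (Q : {measure set TR -> \bar R}) (phi : R -> R)
    (F : R -> \bar R) : has_density_on [set: R] Q phi ->
  measurable_fun [set: TR] F -> (forall y, 0 <= F y) ->
  \int[Q]_y F y = \int[mu]_y (F y * (phi y)%:E).
Proof.
move=> [mphi phi0 QE] mF F0.
have {}phi0 y : (0 <= phi y)%R by exact: phi0.
have mphiE : measurable_fun [set: TR] (EFin \o phi) by exact/measurable_EFinP.
pose h := nnsfun_approx (measurableT : measurable [set: TR]) mF.
have hF y : (EFin \o h n) y @[n --> \oo] --> F y by exact: cvg_nnsfun_approx.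
have h_nd y a b : (a <= b)%N -> (h a y <= h b y)%R.
  by move=> ab; exact/lefP/nd_nnsfun_approx.
have -> : \int[Q]_y F y = lim (\int[Q]_y (EFin \o h n) y @[n --> \oo]).
  under eq_integral => y _ do rewrite -(cvg_lim _ (hF y))//.
  apply: monotone_convergence => //.
  - by move=> n; exact/measurable_EFinP.
  - by move=> n y _ /=; rewrite lee_fin.
  - by move=> y _ a b ab; rewrite lee_fin h_nd.
have -> : \int[mu]_y (F y * (phi y)%:E) =
    lim (\int[mu]_y ((EFin \o h n) y * (phi y)%:E) @[n --> \oo]).
  have Fphi y : F y * (phi y)%:E = lim ((EFin \o h n) y * (phi y)%:E @[n --> \oo]).
    by apply/esym/cvg_lim => //; exact: cvgeZr.
  under eq_integral do rewrite Fphi.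
  apply: monotone_convergence => //.
  - by move=> n; apply: emeasurable_funM => //; exact/measurable_EFinP.
  - by move=> n y _ /=; rewrite mule_ge0 ?lee_fin.
  - by move=> y _ a b ab /=; rewrite lee_wpmul2r ?lee_fin// h_nd.
suff int_h n : \int[Q]_y (EFin \o h n) y = \int[mu]_y ((EFin \o h n) y * (phi y)%:E).
  by under eq_fun do rewrite int_h.
have m_ind r : measurable_fun [set: TR] (fun y => (r * \1_(h n @^-1` [set r]) y)%:E).
  by apply/measurable_EFinP; exact: measurable_funM.
under eq_integral do rewrite /= fimfunE -fsumEFin//.
rewrite ge0_integral_fsum//; last by move=> r y _; exact: nnfun_muleindic_ge0.
under [RHS]eq_integral => y _.
  rewrite /= fimfunE -fsumEFin// ge0_mule_fsuml; last first.
    by move=> r; exact: nnfun_muleindic_ge0.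
  over.
rewrite ge0_integral_fsum//; last 2 first.
- by move=> r; exact: emeasurable_funM.
- move=> r y _; apply: mule_ge0; last by rewrite lee_fin.
  by rewrite EFinM nnfun_muleindic_ge0.
apply: eq_fsbigr => r rhn.
have r0 : (0 <= r)%R by move: rhn; rewrite inE => -[y _ <-].
under eq_integral do rewrite EFinM.
rewrite ge0_integralZl_EFin//; last exact/measurable_EFinP.
rewrite integral_indic// setIT QE//.
under [RHS]eq_integral do rewrite EFinM -muleA.
rewrite ge0_integralZl_EFin//; last 2 first.
- by move=> y _; rewrite mule_ge0 ?lee_fin.
- by apply: emeasurable_funM => //; exact/measurable_EFinP.
congr (_ * _); rewrite [LHS]integral_mkcond; apply: eq_integral => y _.
by rewrite epatch_indic muleC.
Qed.

End density.

Section testing.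
Context (R : realType).
Local Notation TR := (measurableTypeR R).
Local Notation mu := (@lebesgue_measure R).
Variables (Q : probability TR R) (M : R) (phi : R -> R).
Hypothesis Q_dens : has_density_on [set: R] Q phi.
Hypothesis phi_hellinger : forall a : R,
    (\int[mu]_y
       ((Num.sqrt (phi (y - a)) - Num.sqrt (phi y)) ^+ 2)%:E
     <= (M * a ^+ 2)%:E)%E.

Let phi_ge0 y : 0 <= phi y. Proof. by case: Q_dens => _ + _; exact. Qed.

Let mphi_shift (a : R) : measurable_fun [set: TR] (fun y => phi (y - a)).
Proof.
case: Q_dens => mphi _ _; apply: (measurableT_comp mphi).
exact: measurable_funD.
Qed.

Let msqrt_shift (a : R) : measurable_fun [set: TR] (fun y => Num.sqrt (phi (y - a))).
Proof.
apply: measurableT_comp (mphi_shift a); apply: continuous_measurable_fun.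
exact: sqrt_continuous.
Qed.

Lemma integral_shifted_law (a : R) (F : R -> \bar R) :
  measurable_fun [set: TR] F -> (forall y, 0 <= F y)%E ->
  (\int[Q]_y F (y + a)%R = \int[mu]_y (F y * (phi (y - a))%:E))%E.
Proof.
move=> mF F0; rewrite (ge0_integral_density (F := fun y => F (y + a)%R) Q_dens)//.
  rewrite -[RHS](ge0_integral_translation a)//.
  - by apply: eq_integral => y _; rewrite addrK.
  - by apply: emeasurable_funM => //; exact/measurable_EFinP.
  - by move=> y; rewrite mule_ge0 ?lee_fin.
by apply: measurableT_comp mF _; exact: measurable_funD.
Qed.

(** Expand the square in the Hellinger condition; both densities have integral 1. *)
Lemma hellinger_affinity (a b : R) :
  ((1 - M * (a - b) ^+ 2 / 2)%:E <=
   \int[mu]_y (Num.sqrt (phi (y - a)) * Num.sqrt (phi (y - b)))%:E)%E.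
Proof.
set A := (X in (_ <= X)%E).
have int_phi c : (\int[mu]_y (phi (y - c))%:E = 1)%E.
  have := @integral_shifted_law c (cst 1%E) (measurable_cst _) (fun _ => lee01).
  rewrite integral_probability_cst => ->.
  by apply: eq_integral => y _; rewrite mul1e.
have H : (\int[mu]_y ((Num.sqrt (phi (y - a)) - Num.sqrt (phi (y - b))) ^+ 2)%:E
          <= (M * (a - b) ^+ 2)%:E)%E.
  apply: le_trans (phi_hellinger (a - b)).
  rewrite -[leRHS](ge0_integral_translation (- b))//.
  - by under [leRHS]eq_integral do rewrite opprB addrA subrK.
  - apply/measurable_EFinP; apply: measurable_funX; apply: measurable_funB => //.
    by have := msqrt_shift 0; under eq_fun do rewrite subr0.
  - by move=> y; rewrite lee_fin sqr_ge0.
have mAff : measurable_fun [set: TR]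
    (fun y => (Num.sqrt (phi (y - a)) * Num.sqrt (phi (y - b)))%:E).
  by apply/measurable_EFinP; exact: measurable_funM.
have E2 : (2%:E = \int[mu]_y ((Num.sqrt (phi (y - a)) - Num.sqrt (phi (y - b))) ^+ 2)%:E
                  + 2%:E * A)%E.
  rewrite /A -ge0_integralZl_EFin//.
  rewrite -ge0_integralD//; last 3 first.
  - by move=> y _; rewrite lee_fin sqr_ge0.
  - by apply/measurable_EFinP; apply: measurable_funX; exact: measurable_funB.
  - exact: measurable_funeM.
  transitivity (1 + 1 : \bar R)%E; first by rewrite -EFinD.
  rewrite -{1}(int_phi a) -(int_phi b).
  rewrite -ge0_integralD//; last 4 first.
  - by move=> y _; rewrite lee_fin.
  - exact/measurable_EFinP.
  - by move=> y _; rewrite lee_fin.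
  - exact/measurable_EFinP.
  apply: eq_integral => y _; rewrite -EFinM -!EFinD; congr EFin.
  rewrite -{1}(sqr_sqrtr (phi_ge0 (y - a))) -{1}(sqr_sqrtr (phi_ge0 (y - b))).
  by ring.
have : (2%:E <= (M * (a - b) ^+ 2)%:E + 2%:E * A)%E.
  by rewrite [leLHS]E2 leeD2r.
have : (0 <= A)%E by apply: integral_ge0 => y _; rewrite lee_fin mulr_ge0.
case: A E2 => [r _| |]; rewrite ?leey// ?lee_fin -?EFinM -?EFinD ?lee_fin.
by move=> _; lra.
Qed.

(** Truncated at 0 because these bounds are multiplied over the observations. *)
Definition affinity_lb (d : R) : R := Num.max 0 (1 - M * d ^+ 2 / 2).

(** The condition on F and H says that F y * H y >= c^2, in a form that is affine in
    F and H and therefore survives integration. In terms of the densities p^2 and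
    q^2 of the two shifted laws, the condition at t p / q gives
    2 c p q <= t F p^2 + H q^2 / t pointwise. *)
Lemma one_obs_lower_bound (a b c : R) (F H : R -> \bar R) :
  measurable_fun [set: TR] F -> measurable_fun [set: TR] H ->
  (forall y, 0 <= F y)%E -> (forall y, 0 <= H y)%E -> 0 <= c ->
  (forall y t : R, 0 < t -> ((2 * c)%:E <= t%:E * F y + t^-1%:E * H y)%E) ->
  forall t : R, 0 < t ->
  ((2 * (c * affinity_lb (a - b)))%:E <=
   t%:E * \int[Q]_y F (y + a)%R + t^-1%:E * \int[Q]_y H (y + b)%R)%E.
Proof.
move=> mF mH F0 H0 c0 FH t t0.
have t0' := ltW t0; have ti0 : 0 <= t^-1 by rewrite invr_ge0.
rewrite !integral_shifted_law// -!ge0_integralZl_EFin//; last 4 first.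
- by move=> y _; rewrite mule_ge0 ?lee_fin.
- by apply: emeasurable_funM => //; exact/measurable_EFinP.
- by move=> y _; rewrite mule_ge0 ?lee_fin.
- by apply: emeasurable_funM => //; exact/measurable_EFinP.
rewrite -ge0_integralD//; last 4 first.
- by move=> y _; rewrite !mule_ge0 ?lee_fin.
- by apply: measurable_funeM; apply: emeasurable_funM => //; exact/measurable_EFinP.
- by move=> y _; rewrite !mule_ge0 ?lee_fin.
- by apply: measurable_funeM; apply: emeasurable_funM => //; exact/measurable_EFinP.
apply: (@le_trans _ _ (\int[mu]_y ((2 * c)%:E *
    (Num.sqrt (phi (y - a)) * Num.sqrt (phi (y - b)))%:E))%E).
  rewrite ge0_integralZl_EFin ?mulr_ge0//; last first.
    by apply/measurable_EFinP; exact: measurable_funM.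
  rewrite mulrA EFinM lee_wpmul2l ?lee_fin ?mulr_ge0//.
  rewrite /affinity_lb; case: (leP 0 (1 - M * (a - b) ^+ 2 / 2)) => _.
    exact: hellinger_affinity.
  by apply: integral_ge0 => y _; rewrite lee_fin mulr_ge0.
apply: ge0_integral_mono => y; first by rewrite mule_ge0// lee_fin ?mulr_ge0.
set p := Num.sqrt (phi (y - a)); set q := Num.sqrt (phi (y - b)).
have pE : phi (y - a) = p ^+ 2 by rewrite sqr_sqrtr.
have qE : phi (y - b) = q ^+ 2 by rewrite sqr_sqrtr.
have rhs0 : (0 <= t%:E * (F y * (phi (y - a))%:E) +
                  t^-1%:E * (H y * (phi (y - b))%:E))%E.
  by rewrite adde_ge0// !mule_ge0 ?lee_fin.
have [p0|p0] := leP p 0.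
  by rewrite (_ : p = 0) ?mul0r ?mule0//; apply/eqP; rewrite eq_le p0 sqrtr_ge0.
have [q0|q0] := leP q 0.
  by rewrite (_ : q = 0) ?mulr0 ?mule0//; apply/eqP; rewrite eq_le q0 sqrtr_ge0.
have u0 : 0 < t * p / q by rewrite divr_gt0// mulr_gt0.
have pq0 : (0 <= (p * q)%:E)%E by rewrite lee_fin mulr_ge0// ltW.
have := lee_wpmul2l pq0 (FH y _ u0); rewrite [leLHS]muleC => /le_trans; apply.
rewrite ge0_muleDr ?mule_ge0 ?lee_fin ?invr_ge0 ?(ltW u0)//.
rewrite pE qE ![(_ * (_ ^+ 2)%:E)%E]muleC !muleA -!EFinM.
rewrite (_ : p * q * (t * p / q) = t * p ^+ 2); last by field; rewrite gt_eqF.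
rewrite (_ : p * q * (t * p / q)^-1 = t^-1 * q ^+ 2)//.
by field; rewrite !gt_eqF.
Qed.

End testing.

(** * Testing two regression functions *)

Section shifted_samples.
Context (R : realType).
Local Notation TR := (measurableTypeR R).

Definition shift_sample n (a : 'I_n -> R) (e : n.-tuple TR) : n.-tuple TR :=
  [tuple a i + tnth e i | i < n].

Lemma measurable_shift_sample n (a : 'I_n -> R) :
  measurable_fun [set: n.-tuple TR] (shift_sample a).
Proof.
apply/measurable_fun_tnthP => i; rewrite (_ : _ \o _ = fun e => a i + tnth e i).
  by apply: measurable_funD => //; exact: measurable_tnth.
by apply/funext => e /=; rewrite tnth_mktuple.
Qed.

Lemma shift_sample_pcons n (a : 'I_n.+1 -> R) z (e : n.-tuple TR) :
  shift_sample a (pcons (z, e)) = pcons (z + a ord0, shift_sample (a \o lift ord0) e).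
Proof.
apply: eq_from_tnth => j; rewrite tnth_mktuple.
case: (unliftP ord0 j) => [k|] ->.
  by rewrite !tnth_pconsS tnth_mktuple.
by rewrite !tnth_pcons0 addrC.
Qed.

Lemma ge_prod_sum n (rho : 'I_n -> R) : (forall i, 0 <= rho i <= 1) ->
  1 - \sum_i (1 - rho i) <= \prod_i rho i.
Proof.
elim: n rho => [|n IH] rho rho01; first by rewrite !big_ord0 subr0.
rewrite !big_ord_recl /=.
have /andP[r0 r1] := rho01 ord0.
have := IH (rho \o lift ord0) (fun i => rho01 _); rewrite /=.
have : 0 <= \sum_i (1 - rho (lift ord0 i)).
  by apply: sumr_ge0 => i _; rewrite subr_ge0; case/andP: (rho01 (lift ord0 i)).
set S := \sum_i _; set P := \prod_i _ => S0 SP.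
have : rho ord0 * (1 - S) <= rho ord0 * P by exact: ler_wpM2l.
have : rho ord0 * S <= S by rewrite ler_piMl.
by lra.
Qed.

Variables (Q : probability TR R) (M : R) (phi : R -> R).
Hypothesis Q_dens : has_density_on [set: R] Q phi.
Hypothesis M_ge0 : 0 <= M.
Hypothesis phi_hellinger : forall a : R,
    (\int[lebesgue_measure]_y
       ((Num.sqrt (phi (y - a)) - Num.sqrt (phi y)) ^+ 2)%:E
     <= (M * a ^+ 2)%:E)%E.

Let rho (d : R) := affinity_lb M d.

Let rho01 d : 0 <= rho d <= 1.
Proof.
rewrite /rho /affinity_lb le_max lexx/= ge_max ler01/= lerBlDr lerDl.
by rewrite divr_ge0// mulr_ge0// sqr_ge0.
Qed.

(** Integrating out all coordinates but the first gives functions of one variable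
    that satisfy the same condition with c times the product of the other
    affinities. *)
Lemma n_obs_lower_bound n (a b : 'I_n -> R) (c : R)
    (F H : n.-tuple TR -> \bar R) :
  measurable_fun [set: n.-tuple TR] F -> measurable_fun [set: n.-tuple TR] H ->
  (forall y, 0 <= F y)%E -> (forall y, 0 <= H y)%E -> 0 <= c ->
  (forall y (t : R), 0 < t -> ((2 * c)%:E <= t%:E * F y + t^-1%:E * H y)%E) ->
  forall t : R, 0 < t ->
  ((2 * (c * \prod_i rho (a i - b i)))%:E <=
   t%:E * \int[iid_law Q n]_e F (shift_sample a e) +
   t^-1%:E * \int[iid_law Q n]_e H (shift_sample b e))%E.
Proof.
elim: n a b c F H => [|n IH] a b c F H mF mH F0 H0 c0 FH t t0.
  under eq_integral do rewrite (tuple0 (shift_sample a _)).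
  under [X in (_ <= _ + _ * X)%E]eq_integral do rewrite (tuple0 (shift_sample b _)).
  by rewrite !integral_probability_cst big_ord0 mulr1; exact: FH.
have m_cons (u : 'I_n -> R) (K : n.+1.-tuple TR -> \bar R) :
    measurable_fun [set: n.+1.-tuple TR] K ->
    measurable_fun [set: TR * n.-tuple TR] (fun p => K (pcons (p.1, shift_sample u p.2))).
  move=> mK; apply: (measurableT_comp mK); apply: (measurableT_comp (@measurable_pcons _ _ _)).
  apply: measurable_fun_pair => //.
  exact: measurableT_comp (measurable_shift_sample u) measurable_snd.
have iter (u : 'I_n.+1 -> R) (K : n.+1.-tuple TR -> \bar R) :
    measurable_fun [set: n.+1.-tuple TR] K -> (forall y, 0 <= K y)%E ->
    (\int[iid_law Q n.+1]_e K (shift_sample u e) = \int[Q]_z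
      (fun y => \int[iid_law Q n]_e K (pcons (y, shift_sample (u \o lift ord0) e)))
      (z + u ord0)%R)%E.
  move=> mK K0; rewrite integral_iid_cons//; last first.
    exact: measurableT_comp mK (measurable_shift_sample u).
  by under eq_integral do under eq_integral do rewrite shift_sample_pcons.
rewrite !iter// big_ord_recl.
rewrite (_ : c * _ = (c * \prod_i rho ((a \o lift ord0) i - (b \o lift ord0) i))
  * affinity_lb M (a ord0 - b ord0)); last by rewrite /rho /= mulrCA mulrC.
apply: (@one_obs_lower_bound R Q M phi Q_dens phi_hellinger (a ord0) (b ord0) _
  (fun y => \int[iid_law Q n]_e F (pcons (y, shift_sample (a \o lift ord0) e)))%E
  (fun y => \int[iid_law Q n]_e H (pcons (y, shift_sample (b \o lift ord0) e)))%E) => //.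
- exact: (measurable_fun_fubini_tonelli_F _ (m_cons (a \o lift ord0) _ mF)).
- exact: (measurable_fun_fubini_tonelli_F _ (m_cons (b \o lift ord0) _ mH)).
- by move=> y; exact: integral_ge0.
- by move=> y; exact: integral_ge0.
- by rewrite mulr_ge0// prodr_ge0// => i _; case/andP: (rho01 ((a \o lift ord0) i - (b \o lift ord0) i)).
move=> y t' t'0; apply: (IH (a \o lift ord0) (b \o lift ord0) c
  (fun e => F (pcons (y, e))) (fun e => H (pcons (y, e)))) => //.
- exact: measurableT_comp mF (measurableT_comp (@measurable_pcons _ _ _) (pair1_measurable y)).
- exact: measurableT_comp mH (measurableT_comp (@measurable_pcons _ _ _) (pair1_measurable y)).
- by move=> e u u0; exact: FH.
Qed.

Variables (G : cumulativeBounded (0 : R) (1 : R)) (n : nat) (f0 f1 : R -> R).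
Hypothesis mf0 : measurable_fun [set: TR] (f0 \_ `[-1, 1]).
Hypothesis mf1 : measurable_fun [set: TR] (f1 \_ `[-1, 1]).

Lemma measurable_observe (f : R -> R) :
  measurable_fun [set: TR] (f \_ `[-1, 1]) ->
  measurable_fun [set: n.-tuple TR * n.-tuple TR] (@observe R n f).
Proof.
move=> mf; apply: measurable_fun_pair => //; apply/measurable_fun_tnthP => i.
rewrite (_ : _ \o _ = fun w => (f \_ `[-1, 1]) (tnth w.1 i) + tnth w.2 i).
  apply: measurable_funD.
    exact: measurableT_comp mf (measurableT_comp (measurable_tnth i) measurable_fst).
  exact: measurableT_comp (measurable_tnth i) measurable_snd.
by apply/funext => w /=; rewrite tnth_mktuple.
Qed.

Variables (J : set TR) (kappa s : R) (A : set (n.-tuple TR * n.-tuple TR)).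
Hypothesis mJ : measurable J.
Hypothesis mA : measurable A.
Hypothesis s_gt1 : 1 < s.
Hypothesis f01_close : forall u,
  `|(f0 \_ `[-1, 1]) u - (f1 \_ `[-1, 1]) u| <= kappa * \1_J u.

(** The probability of B given the design. *)
Let power (f : R -> R) B x : \bar R := iid_law Q n (xsection (observe f @^-1` B) x).

(** Apply [n_obs_lower_bound] with c = t = 1 to the function F that is s on A and
    1 / s elsewhere, and to 1 / F. *)
Let conditional_two_point (x : n.-tuple TR) :
  (2%:E <= (2 / s)%:E + (s - s^-1)%:E * (power f0 A x + power f1 (~` A) x) +
   (M * kappa ^+ 2)%:E * (\sum_(i < n) \1_J (tnth x i))%:E)%E.
Proof.
have s0 : 0 < s by exact: lt_trans s_gt1.
have ds : 0 <= s - s^-1 by rewrite subr_ge0 (le_trans _ (ltW s_gt1))// invf_le1// ltW.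
pose a i := (f0 \_ `[-1, 1]) (tnth x i); pose b i := (f1 \_ `[-1, 1]) (tnth x i).
pose Ax : set (n.-tuple TR) := [set y | A (y, x)].
have mAx : measurable Ax.
  rewrite (_ : Ax = ysection A x); first exact: measurable_ysection.
  by apply/seteqP; split => y; rewrite /ysection /= inE.
pose test (B : set (n.-tuple TR)) y : \bar R := (s^-1 + (s - s^-1) * \1_B y)%:E.
have test0 B y : (0 <= test B y)%E.
  by rewrite lee_fin addr_ge0 ?mulr_ge0// invr_ge0 ltW.
have mtest B : measurable B -> measurable_fun [set: n.-tuple TR] (test B).
  move=> mB; apply/measurable_EFinP; apply: measurable_funD => //.
  by apply: measurable_funM => //; exact: measurable_indic.
have test_pair y (t : R) : 0 < t ->
    ((2 * 1)%:E <= t%:E * test Ax y + t^-1%:E * test (~` Ax) y)%E.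
  move=> t0; rewrite mulr1 -!EFinM -EFinD lee_fin indicC /=.
  have am_gm (u : R) : 0 < u -> 2 <= u + u^-1.
    move=> u0; have : 0 <= (u - 1) ^+ 2 * u^-1 by rewrite mulr_ge0 ?sqr_ge0 ?invr_ge0 ?ltW.
    have -> : (u - 1) ^+ 2 * u^-1 = u + u^-1 - 2 by field; rewrite gt_eqF.
    by rewrite subr_ge0.
  rewrite indicE; case: (y \in Ax) => /=.
    have := am_gm (t * s) (mulr_gt0 t0 s0); rewrite invfM; lra.
  have /am_gm : 0 < t / s by exact: divr_gt0.
  by rewrite invf_div; lra.
have int_test B (u : 'I_n -> R) : measurable B ->
    (\int[iid_law Q n]_e test B (shift_sample u e) =
     s^-1%:E + (s - s^-1)%:E * iid_law Q n (shift_sample u @^-1` B))%E.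
  move=> mB; have mpre : measurable (shift_sample u @^-1` B).
    by rewrite -[X in measurable X]setTI; exact: measurable_shift_sample.
  under eq_integral do rewrite /test EFinD EFinM.
  rewrite ge0_integralD//; last 3 first.
  - by move=> e _; rewrite lee_fin invr_ge0 ltW.
  - by move=> e _; rewrite mule_ge0 ?lee_fin.
  - apply: measurable_funeM; apply/measurable_EFinP.
    by apply: measurableT_comp (measurable_shift_sample u); exact: measurable_indic.
  rewrite integral_probability_cst ge0_integralZl_EFin//; last first.
    apply/measurable_EFinP.
    by apply: measurableT_comp (measurable_shift_sample u); exact: measurable_indic.
  by rewrite (integral_indic _ _ mpre)// setIT.
have := n_obs_lower_bound a b (mtest _ mAx) (mtest _ (measurableC mAx))
  (test0 _) (test0 _) ler01 test_pair ltr01.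
rewrite !int_test//; last exact: measurableC.
have -> : iid_law Q n (shift_sample a @^-1` Ax) = power f0 A x.
  by congr (iid_law Q n _); apply/seteqP; split => e; rewrite /xsection /= inE.
have -> : iid_law Q n (shift_sample b @^-1` (~` Ax)) = power f1 (~` A) x.
  by congr (iid_law Q n _); apply/seteqP; split => e; rewrite /xsection /= inE.
have prod_ge : 1 - M * kappa ^+ 2 / 2 * \sum_(i < n) \1_J (tnth x i) <=
               \prod_(i < n) rho (a i - b i).
  apply: le_trans (ge_prod_sum (fun i => rho01 (a i - b i))).
  rewrite lerD2l lerN2 mulr_sumr; apply: ler_sum => i _.
  rewrite lerBlDr -lerBlDl /rho /affinity_lb le_max; apply/orP; right.
  rewrite lerD2l lerN2 [leRHS]mulrAC ler_pM2r// -mulrA ler_wpM2l//.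
  have := f01_close (tnth x i); rewrite -/(a i) -/(b i) indicE.
  case: (_ \in J); rewrite ?mulr1 ?mulr0 => dab.
    rewrite -(real_normK (num_real (a i - b i))) lerXn2r// nnegrE//.
    by rewrite (le_trans _ dab).
  have -> : a i - b i = 0 by apply/eqP; rewrite -normr_le0.
  by rewrite expr0n.
have pf (f : R -> R) B : (0 <= power f B x)%E by exact: measure_ge0.
rewrite invr1 !mul1e mul1r => H.
apply: (@le_trans _ _ ((2 * \prod_(i < n) rho (a i - b i))%:E +
    (M * kappa ^+ 2 * \sum_(i < n) \1_J (tnth x i))%:E)%E).
  by rewrite -EFinD lee_fin; lra.
rewrite -[X in (_ <= _ + X)%E]EFinM leeD2r// (le_trans H)// ge0_muleDr//.
rewrite addeACA -EFinD; apply: leeD2r; rewrite lee_fin.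
by lra.
Qed.

(** A lower bound on the sum of the errors of the test A of f0 against f1. The last
    term bounds the loss of affinity; s is a free parameter, to be matched to the
    level of the errors. *)
Lemma two_point_inequality :
  (2%:E <= (2 / s)%:E +
     (s - s^-1)%:E * (data_law G Q f0 A + data_law G Q f1 (~` A)) +
     (M * kappa ^+ 2 * n%:R)%:E * law_of_cdf G J)%E.
Proof.
have s0 : 0 < s by exact: lt_trans s_gt1.
have ds : 0 <= s - s^-1 by rewrite subr_ge0 (le_trans _ (ltW s_gt1))// invf_le1// ltW.
have s20 : (0 <= (2 / s)%:E :> \bar R)%E by rewrite lee_fin divr_ge0// ltW.
have mpower f B : measurable_fun [set: TR] (f \_ `[-1, 1]) -> measurable B ->
    measurable_fun [set: n.-tuple TR] (power f B).
  move=> mf mB; apply: measurable_fun_xsection.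
  by rewrite -[X in measurable X]setTI; exact: measurable_observe.
have p0 f B x : (0 <= power f B x)%E by exact: measure_ge0.
have mS : measurable_fun [set: n.-tuple TR] (fun x => (\sum_(i < n) \1_J (tnth x i))%:E : \bar R).
  apply/measurable_EFinP; apply: measurable_sum => i.
  by apply: measurableT_comp (measurable_tnth i); exact: measurable_indic.
have S0 (x : n.-tuple TR) : (0 <= (\sum_(i < n) \1_J (tnth x i))%:E :> \bar R)%E.
  by rewrite lee_fin sumr_ge0.
have Mk0' : 0 <= M * kappa ^+ 2 by rewrite mulr_ge0// sqr_ge0.
have Mk0 : (0 <= (M * kappa ^+ 2)%:E :> \bar R)%E by rewrite lee_fin.
rewrite -[leLHS](integral_probability_cst (iid_law (law_of_cdf G) n)).
apply: le_trans (ge0_integral_mono _ _ conditional_two_point) _ => //.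
rewrite ge0_integralD//; last 4 first.
- by move=> x _; rewrite adde_ge0// mule_ge0 ?lee_fin ?adde_ge0.
- apply: emeasurable_funD => //; apply: measurable_funeM; apply: emeasurable_funD.
    exact: mpower.
  by apply: mpower => //; exact: measurableC.
- by move=> x _; rewrite mule_ge0.
- exact: measurable_funeM.
apply: leeD.
  rewrite ge0_integralD//; last 2 first.
  - by move=> x _; rewrite mule_ge0 ?lee_fin ?adde_ge0.
  - apply: measurable_funeM; apply: emeasurable_funD; first exact: mpower.
    by apply: mpower => //; exact: measurableC.
  rewrite integral_probability_cst ge0_integralZl_EFin//; last 2 first.
  - by move=> x _; rewrite adde_ge0.
  - apply: emeasurable_funD; first exact: mpower.
    by apply: mpower => //; exact: measurableC.
  rewrite ge0_integralD//; first exact: mpower.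
  by apply: mpower => //; exact: measurableC.
rewrite ge0_integralZl_EFin//.
rewrite integral_iid_sum//.
by rewrite integral_indic// setIT muleA -EFinM.
Qed.

End shifted_samples.

(** * The design near 0 and the local alternative *)

Section design_mass.
Context (R : realType).
Local Notation TR := (measurableTypeR R).
Local Notation mu := (@lebesgue_measure R).

Lemma density_mass_bounds (P : {measure set TR -> \bar R}) (g : R -> R)
    (U A : set TR) (lo hi : R) : has_density_on U P g ->
  measurable U -> measurable A -> A `<=` U -> 0 <= lo ->
  (forall u, A u -> lo <= g u <= hi) ->
  (lo%:E * mu A <= P A <= hi%:E * mu A)%E.
Proof.
move=> [mg g0 PE] mU mA AU lo0 lohi; rewrite PE//.
have mgA : measurable_fun A (EFin \o g).
  by apply/measurable_EFinP; exact: measurable_funS mg.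
rewrite -!integral_cst//; apply/andP; split; apply: ge0_le_integral => //.
- by move=> u Au; rewrite lee_fin; case/andP: (lohi _ Au).
- by move=> u Au; rewrite lee_fin; exact: g0 (AU _ Au).
- by move=> u Au; rewrite lee_fin; case/andP: (lohi _ Au).
Qed.

(** Near 0 the density lies between g 0 / 2 and 2 g 0. Bandwidths up to 1 are covered
    by shrinking delta to delta d in the lower bounds, and by the trivial
    bound 1 in the upper bound. *)
Lemma design_mass (P : probability TR R) (g : R -> R) (U : set R) :
  open_nbhs 0 U -> has_density_on U P g -> {for 0, continuous g} -> 0 < g 0 ->
  exists b B : R, [/\ 0 < b, 0 < B & forall delta, 0 < delta <= 1 ->
    [/\ ((b * delta)%:E <= P [set u | (0 <= u <= delta)%R])%E,
        ((b * delta)%:E <= P [set u | (- delta <= u < 0)%R])%E &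
        (P [set u | (`|u| <= 2 * delta)%R] <= (B * delta)%:E)%E]].
Proof.
move=> U0 P_dens g_cont g0.
have [d [d0 d1 dP]] : exists d, [/\ 0 < d, d <= 1 &
    forall u, `|u| <= d -> U u /\ g 0 / 2 <= g u <= 2 * g 0].
  have g02 : 0 < g 0 / 2 by rewrite divr_gt0.
  have near_g : \forall u \near (0 : R), `|g 0 - g u| < g 0 / 2.
    by have /cvgrPdist_lt/(_ _ g02) := g_cont.
  have near_U : \forall u \near (0 : R), U u by exact: open_nbhs_nbhs.
  have /nbhs_ballP[e /= e0 eP] : \forall u \near (0 : R), U u /\ `|g 0 - g u| < g 0 / 2.
    by apply: filterI near_U near_g.
  exists (Num.min 1 (e / 2)); split.
  - by rewrite lt_min ltr01 divr_gt0.
  - by rewrite ge_min lexx.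
  move=> u ud; have /eP[Uu gu] : ball (0 : R) e u.
    rewrite /ball /= sub0r normrN (le_lt_trans ud)// gt_min; apply/orP; right.
    by rewrite ltr_pdivrMr// ltr_pMr// ltr1n.
  split => //; move: gu; rewrite ltr_distl => /andP[g1 g2].
  by apply/andP; split; lra.
have mass (i : interval R) (A : set TR) : A = [set` i] :> set R ->
    (forall u, A u -> `|u| <= d) ->
    ((g 0 / 2)%:E * mu A <= P A <= (2 * g 0)%:E * mu A)%E.
  move=> Ai Ad; apply: (density_mass_bounds (U := U) P_dens).
  - by apply: open_measurable; case: U0.
  - by rewrite Ai.
  - by move=> u /Ad/dP[].
  - by rewrite divr_ge0// ltW.
  - by move=> u /Ad/dP[].
have mP (A : set TR) (i : interval R) : A = [set` i] :> set R -> measurable A.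
  by move=> ->.
exists (g 0 * d / 2), (8 * g 0 + 2 / d); split.
- by rewrite divr_gt0// mulr_gt0.
- by apply: addr_gt0; [exact: mulr_gt0|exact: divr_gt0].
move=> delta /andP[delta0 delta1].
pose h := delta * d.
have h0 : 0 < h by rewrite mulr_gt0.
have hd : h <= d by rewrite ler_piMl// ltW.
have hdelta : h <= delta by rewrite ler_piMr// ltW.
split.
- apply: (@le_trans _ _ (P [set` `[(0 : R), h]])); last first.
    apply: le_measure; rewrite ?inE//.
    + by apply: (mP _ `[0, delta]); apply/seteqP; split => u /=; rewrite in_itv.
    + by move=> u /=; rewrite in_itv/= => /andP[-> uh]; rewrite (le_trans uh).
  have /(mass `[0, h] _ erefl)/andP[+ _] : forall u : TR, [set` `[(0 : R), h]] u -> `|u| <= d.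
    move=> u /=; rewrite in_itv/= => /andP[u0 uh].
    by rewrite ger0_norm// (le_trans uh).
  apply: le_trans; rewrite lebesgue_measure_itv/= lte_fin h0 -EFinB subr0 -EFinM.
  by rewrite lee_fin /h; lra.
- apply: (@le_trans _ _ (P [set` `[- h, 0[])); last first.
    apply: le_measure; rewrite ?inE//.
    + by apply: (mP _ `[- delta, 0[); apply/seteqP; split => u /=; rewrite in_itv.
    + move=> u /=; rewrite in_itv/= => /andP[hu ->]; rewrite andbT.
      by rewrite (le_trans _ hu)// lerN2.
  have /(mass `[- h, 0[ _ erefl)/andP[+ _] : forall u : TR, [set` `[- h, 0[] u -> `|u| <= d.
    move=> u /=; rewrite in_itv/= => /andP[hu u0].
    by rewrite ltr0_norm// lerNl (le_trans _ hu)// lerN2.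
  apply: le_trans; rewrite lebesgue_measure_itv/= lte_fin oppr_lt0 h0 -EFinB sub0r opprK -EFinM.
  by rewrite lee_fin /h; lra.
- have itvE : [set u : TR | `|u| <= 2 * delta] = [set` `[- (2 * delta), 2 * delta]].
    by apply/seteqP; split => u /=; rewrite in_itv/= ler_norml.
  have [dd|dd] := leP (2 * delta) d; last first.
    apply: (@le_trans _ _ 1%E); first by apply: probability_le1; rewrite itvE.
    rewrite lee_fin mulrDl ler_wpDl//; first by rewrite !mulr_ge0// ltW.
    by rewrite mulrAC ler_pdivlMr// mul1r ltW.
  have /andP[_] := mass _ _ itvE (fun u ud => le_trans ud dd).
  move/le_trans; apply; rewrite itvE lebesgue_measure_itv/= lte_fin.
  rewrite ifT; last by lra.
  rewrite -EFinB -EFinM lee_fin.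
  have : 0 <= 2 / d * delta by apply: mulr_ge0; rewrite ?divr_ge0// ltW.
  by lra.
Qed.

End design_mass.

Section local_alternative.
Context (R : realType).
Implicit Types (f : R -> R) (delta kappa w c : R).

Definition close_alternative f0 delta kappa w f1 :=
  [/\ nondecreasing_on_itv f1, `|f1 0 - f0 0| = kappa,
      forall u, u \in `[-1, 1] ->
        `|f0 u - f1 u| <= kappa * \1_[set v : R | `|v| <= 2 * delta] u,
      f1 delta <= f1 0 + (w + kappa) & f1 0 - (w + kappa) <= f1 (- delta)].

(** Beyond 2 delta the function f0 is already above the new level, so the maximum
    changes nothing there. *)
Lemma raise_right f0 delta kappa w : nondecreasing_on_itv f0 ->
  0 < delta <= 1 -> 0 <= kappa -> 0 <= w ->
  f0 delta <= f0 0 + w -> f0 0 - w <= f0 (- delta) ->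
  (2 * delta <= 1 -> f0 0 + kappa <= f0 (2 * delta)) ->
  exists f1, close_alternative f0 delta kappa w f1.
Proof.
move=> nd /andP[d0 d1] k0 w0 fR fL jump.
have in0 : (0 : R) \in `[-1, 1] by rewrite in_itv/= oppr_le0 ler01.
pose f1 u := if 0 <= u then Num.max (f0 u) (f0 0 + kappa) else f0 u.
have f10 : f1 0 = f0 0 + kappa.
  by rewrite /f1 lexx; apply/max_idPr; rewrite lerDl.
exists f1; split.
- move=> u v uI vI uv; rewrite /f1; have [u0|u0] := leP 0 u.
    rewrite (le_trans u0 uv) ge_max !le_max lexx orbT andbT.
    by rewrite (nd _ _ uI vI uv).
  by case: ifP => _; rewrite ?le_max (nd _ _ uI vI uv).
- by rewrite f10 addrAC subrr add0r ger0_norm.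
- move=> u uI; rewrite /f1; have [u0|u0] := leP 0 u; last first.
    by rewrite subrr normr0 mulr_ge0.
  have f0u : f0 0 <= f0 u by exact: nd.
  rewrite indicE; have [_|nu] := boolP (u \in _).
    by rewrite mulr1 maxElt; case: ltP => h; rewrite ler_norml; lra.
  have u2 : 2 * delta < u.
    by move: nu; rewrite notin_setE /= ger0_norm// => /negP; rewrite -ltNge.
  have u1 : u <= 1 by move: uI; rewrite in_itv/= => /andP[].
  have d21 : 2 * delta <= 1 by rewrite (le_trans (ltW u2)).
  have /max_idPl -> : f0 0 + kappa <= f0 u.
    apply: (le_trans (jump d21)); apply: nd => //; last exact: ltW.
    by rewrite in_itv/= d21 andbT; lra.
  by rewrite subrr normr0 mulr0.
- by rewrite f10 /f1 (ltW d0) ge_max; apply/andP; split; lra.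
- by rewrite f10 /f1 (_ : (0 <= - delta) = false) ?oppr_ge0 ?leNgt ?d0//=; lra.
Qed.

(** The mirror image of [raise_right], under f |-> - f (- _). *)
Lemma lower_left f0 delta kappa w : nondecreasing_on_itv f0 ->
  0 < delta <= 1 -> 0 <= kappa -> 0 <= w ->
  f0 delta <= f0 0 + w -> f0 0 - w <= f0 (- delta) ->
  (2 * delta <= 1 -> f0 (- (2 * delta)) <= f0 0 - kappa) ->
  exists f1, close_alternative f0 delta kappa w f1.
Proof.
move=> nd d01 k0 w0 fR fL jump.
have symI u : u \in `[(-1 : R), 1] -> - u \in `[(-1 : R), 1].
  by rewrite !in_itv/= => /andP[? ?]; apply/andP; split; lra.
pose refl (f : R -> R) u := - f (- u).
have [||||f1 [nd1 f10 close f1R f1L]] := @raise_right (refl f0) delta kappa w _ d01 k0 w0.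
- by move=> u v uI vI uv; rewrite lerN2; apply: nd; rewrite ?symI// lerN2.
- by rewrite /refl oppr0; lra.
- by rewrite /refl oppr0 opprK; lra.
- by move=> /jump; rewrite /refl oppr0; lra.
exists (refl f1); split.
- by move=> u v uI vI uv; rewrite lerN2; apply: nd1; rewrite ?symI// lerN2.
- by move: f10; rewrite /refl oppr0 -opprD normrN opprK addrC.
- move=> u uI; have := close _ (symI _ uI).
  rewrite /refl opprK -opprD normrN !indicE.
  have -> : (- u \in [set v : R | `|v| <= 2 * delta]) = (u \in [set v : R | `|v| <= 2 * delta]).
    by apply/idP/idP; rewrite !inE/= normrN.
  by rewrite opprK addrC.
- by move: f1L; rewrite /refl oppr0; lra.
- by move: f1R; rewrite /refl oppr0 opprK; lra.
Qed.

Definition rate (n : nat) c delta : R := c / Num.sqrt (n%:R * delta).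

(** The least k such that 2^-k satisfies the bound exists because the rate tends to
    infinity as delta tends to 0; the bound fails at 2 delta by minimality, and
    the rate there is at least half the rate at delta. *)
Lemma critical_bandwidth f0 (n : nat) c : nondecreasing_on_itv f0 ->
  (0 < n)%N -> 0 < c ->
  exists delta, [/\ 0 < delta <= 1,
    f0 delta - f0 (- delta) <= rate n c delta &
    delta = 1 \/ 2 * delta <= 1 /\
      rate n c delta / 2 < f0 (2 * delta) - f0 (- (2 * delta))].
Proof.
move=> nd n0 c0; have n0' : 0 < n%:R :> R by rewrite ltr0n.
pose dy (k : nat) : R := 2 ^- k.
have dy0 k : 0 < dy k by rewrite invr_gt0 exprn_gt0.
have dy1 k : dy k <= 1 by rewrite invf_le1 ?exprn_gt0// exprn_ege1// ler1n.
have dyI k : (dy k \in `[(-1 : R), 1]) && (- dy k \in `[(-1 : R), 1]).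
  by rewrite !in_itv/=; have := dy0 k; have := dy1 k => ? ?; apply/andP; split; lra.
pose P k := f0 (dy k) - f0 (- dy k) <= rate n c (dy k).
have exP : exists k, P k.
  pose D := f0 1 - f0 (- 1).
  have in1 : (1 : R) \in `[-1, 1] by rewrite in_itv/=; apply/andP; split; lra.
  have inN1 : (- 1 : R) \in `[-1, 1] by rewrite in_itv/=; apply/andP; split; lra.
  have D0 : 0 <= D by rewrite subr_ge0; apply: nd => //; lra.
  pose k := (Num.truncn (D ^+ 2 * n%:R / c ^+ 2)).+1.
  exists k; rewrite /P /rate; have /andP[iR iL] := dyI k.
  apply: (@le_trans _ _ D).
    by apply: lerB; apply: nd => //; rewrite lerN2.
  have nd0 : 0 < n%:R * dy k by rewrite mulr_gt0.
  rewrite ler_pdivlMr ?sqrtr_gt0//.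
  rewrite -[leLHS]ger0_norm ?mulr_ge0// -(ger0_norm (ltW c0)).
  rewrite -ler_sqr ?nnegrE// -!normrX !ger0_norm ?sqr_ge0// exprMn sqr_sqrtr ?(ltW nd0)//.
  rewrite mulrA /dy ler_pdivrMr ?exprn_gt0// [leRHS]mulrC -ler_pdivrMr ?exprn_gt0//.
  have := truncnS_gt (D ^+ 2 * n%:R / c ^+ 2); rewrite -/k => /ltW/le_trans; apply.
  by rewrite -natrX ler_nat ltnW// ltn_expl.
case: (ex_minnP exP) => k Pk kmin.
exists (dy k); split=> //; first by rewrite dy0 dy1.
case: k Pk kmin => [|k] Pk kmin; first by left; rewrite /dy expr0 invr1.
right; have dyS : 2 * dy k.+1 = dy k by rewrite /dy exprS invfM mulrA divff// mul1r.
rewrite dyS; split; first exact: dy1.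
have : ~~ P k by apply/negP => /kmin; rewrite ltnn.
rewrite -ltNge; apply: le_lt_trans; rewrite /rate -mulrA ler_pM2l// -invfM.
have nd0 : 0 < n%:R * dy k.+1 by rewrite mulr_gt0.
have nd1 : 0 < n%:R * dy k by rewrite mulr_gt0.
rewrite lef_pV2 ?posrE ?mulr_gt0 ?sqrtr_gt0//.
have -> : Num.sqrt (n%:R * dy k.+1) * 2 = Num.sqrt (n%:R * dy k.+1 * 4).
  rewrite [RHS]sqrtrM ?(ltW nd0)//; congr (_ * _).
  by rewrite -[4%:R]/((2 * 2)%:R) natrM -expr2 sqrtr_sqr ger0_norm.
by apply: ler_wsqrtr; rewrite -dyS; lra.
Qed.

(** At the critical bandwidth f0 moves by at least w / 4 on one side of 0 within
    distance 2 delta; if delta = 1 the whole interval is within that distance. *)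
Lemma local_alternative f0 (n : nat) c : nondecreasing_on_itv f0 ->
  (0 < n)%N -> 0 < c ->
  exists delta f1, let w := rate n c delta in
    [/\ 0 < delta <= 1, f0 delta <= f0 0 + w, f0 0 - w <= f0 (- delta),
        close_alternative f0 delta (w / 4) w f1 &
        delta = 1 \/ 2 * delta <= 1 /\ w / 2 < f0 (2 * delta) - f0 (- (2 * delta))].
Proof.
move=> nd n0 c0.
have [delta [d01 osc crit]] := critical_bandwidth nd n0 c0.
exists delta; have /andP[d0 d1] := d01.
set w := rate n c delta in osc crit *.
have w0 : 0 <= w by rewrite divr_ge0// ltW.
have in0 : (0 : R) \in `[-1, 1] by rewrite in_itv/=; apply/andP; split; lra.
have ind : delta \in `[-1, 1] by rewrite in_itv/=; apply/andP; split; lra.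
have inNd : - delta \in `[-1, 1] by rewrite in_itv/=; apply/andP; split; lra.
have fR : f0 0 <= f0 delta by apply: nd => //; exact: ltW.
have fL : f0 (- delta) <= f0 0 by apply: nd => //; lra.
have gR : f0 delta <= f0 0 + w by lra.
have gL : f0 0 - w <= f0 (- delta) by lra.
have k0 : 0 <= w / 4 by rewrite divr_ge0.
have [jr|jr] := leP (f0 0 + w / 4) (f0 (2 * delta)).
  by have [//|f1 H] := raise_right nd d01 k0 w0 gR gL; exists f1.
have [jl|jl] := leP (f0 (- (2 * delta))) (f0 0 - w / 4).
  by have [//|f1 H] := lower_left nd d01 k0 w0 gR gL; exists f1.
have d1' : delta = 1 by case: crit => // -[_]; lra.
have [|f1 H] := raise_right nd d01 k0 w0 gR gL; last by exists f1; split=> //; left.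
by rewrite d1'; lra.
Qed.

(** If n delta < K then 2 delta is close to 0, and the jump of f0 between - 2 delta
    and 2 delta would exceed a fixed positive number. *)
Lemma bandwidth_not_too_small f0 c K : {for 0, continuous f0} -> 0 < c -> 0 < K ->
  \forall n \near \oo, forall delta, 0 < delta ->
    (delta = 1 \/ 2 * delta <= 1 /\
      rate n c delta / 2 < f0 (2 * delta) - f0 (- (2 * delta))) ->
    K <= n%:R * delta.
Proof.
move=> f0_cont c0 K0; pose e := c / Num.sqrt K / 4.
have e0 : 0 < e by rewrite !divr_gt0 ?sqrtr_gt0.
have /nbhs_ballP[d /= d0 dP] : \forall u \near (0 : R), `|f0 0 - f0 u| < e.
  by have /cvgrPdist_lt/(_ _ e0) := f0_cont.
near=> n => delta delta0 crit; rewrite leNgt; apply/negP => ndK.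
have Kn : K <= n%:R by near: n; exact: nbhs_infty_ger.
have n0 : 0 < n%:R :> R by exact: lt_le_trans Kn.
have Kdn : 2 * K / d <= n%:R by near: n; exact: nbhs_infty_ger.
case: crit => [d1|[_ jump]]; first by move: ndK; rewrite d1 mulr1 ltNge Kn.
have d2 : 2 * delta < d.
  by rewrite ler_pdivrMr// in Kdn; rewrite -(ltr_pM2r n0); lra.
have dist u : `|u| < d -> `|f0 0 - f0 u| < e.
  by move=> ud; apply: dP; rewrite /ball /= sub0r normrN.
have := dist (2 * delta); rewrite ger0_norm ?mulr_ge0 ?ltW// => /(_ d2).
have := dist (- (2 * delta)); rewrite normrN ger0_norm ?mulr_ge0 ?ltW// => /(_ d2).
rewrite !ltr_distl => /andP[a1 a2] /andP[a3 a4].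
have : rate n c delta / 2 >= 2 * e.
  rewrite /e /rate; have -> : 2 * (c / Num.sqrt K / 4) = c / Num.sqrt K / 2.
    by field; rewrite gt_eqF// sqrtr_gt0.
  rewrite ler_pM2r// ler_pM2l// lef_pV2 ?posrE ?sqrtr_gt0 ?mulr_gt0//.
  by rewrite ler_sqrt// ltW.
by lra.
Unshelve. all: by end_near. Qed.

End local_alternative.

(** * Minimax lower bound from two points *)

Section limits_of_sequences.
Local Open Scope ereal_scope.
Context (R : realType).
Implicit Types (u : (\bar R)^nat) (l : \bar R).

Lemma limn_esup_le_near u l : (\forall n \near \oo, u n <= l) -> limn_esup u <= l.
Proof.
move=> [N _ uN]; rewrite limn_esup_lim; apply: lime_le; first exact: is_cvg_esups.
exists N => // n /= Nn; apply: ge_ereal_sup => _ [k /= nk <-].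
by apply: uN => /=; exact: leq_trans nk.
Qed.

Lemma limn_einf_ge_near u l : (\forall n \near \oo, l <= u n) -> l <= limn_einf u.
Proof.
move=> [N _ uN]; rewrite limn_einf_lim; apply: lime_ge; first exact: is_cvg_einfs.
exists N => // n /= Nn; apply: le_ereal_inf_tmp => _ [k /= nk <-].
by apply: uN => /=; exact: leq_trans nk.
Qed.

End limits_of_sequences.

Section model_facts.
Context (R : realType).
Local Notation TR := (measurableTypeR R).

(** On the interval, f agrees with its composition with the projection of the line
    onto the interval, which is nondecreasing on the whole line. *)
Lemma nondecreasing_on_itv_measurable (f : R -> R) : nondecreasing_on_itv f ->
  measurable_fun [set: TR] (f \_ `[-1, 1]).
Proof.
move=> nd; apply/(measurable_restrictT _ _).1 => //.
pose clip (u : R) := Num.max (- 1) (Num.min 1 u).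
have clipI u : clip u \in `[-1, 1].
  rewrite in_itv/= /clip le_max lexx/= ge_max ge_min lexx/= andbT; lra.
apply: (@eq_measurable_fun _ _ _ _ _ (f \o clip)).
  move=> u; rewrite inE/= in_itv/= => /andP[u1 u2]; rewrite /clip.
  by rewrite (min_idPr u2) (max_idPr u1).
apply: nondecreasing_measurable => // u v uv; apply: nd => //.
have uv1 : Num.min 1 u <= Num.min 1 v by rewrite le_min !ge_min lexx uv orbT.
by rewrite /clip ge_max !le_max lexx/= uv1 orbT.
Qed.

Lemma second_moments (Q : probability TR R) (sigma : R) :
  ('E_Q[idfun] = 0)%E -> ('V_Q[idfun] = (sigma ^+ 2)%:E)%E ->
  (\int[Q]_z z%:E = 0)%E /\ (\int[Q]_z (z ^+ 2)%:E = (sigma ^+ 2)%:E)%E.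
Proof.
move=> E0 V; split; first by rewrite unlock in E0.
rewrite -V /variance unlock E0 /= unlock; apply: eq_integral => z _.
by rewrite -[((_ \- _) * _) z]/((z - 0) * (z - 0)) subr0 -expr2.
Qed.

Lemma data_law_mono (G : cumulativeBounded (0 : R) (1 : R)) (Q : probability TR R)
    n (f : R -> R) :
  {homo @data_law R G Q n f : A B / A `<=` B >-> (A <= B)%E}.
Proof.
move=> A B AB; apply: product_measure1_mono; first exact: iid_law_mono.
by move=> w; exact: AB.
Qed.

(** An estimator that errs by less than rad under f0 errs by at least rad under f1, so
    the event of a large error under f0 is a test of f0 against f1. If both of
    its errors were below beta, the choice s = 1 / (2 beta) in the two-point
    inequality would leave a gap of (1 - 2 beta)^2. *)
Lemma minimax_two_point (Q : probability TR R) (M : R) (phi : R -> R)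
    (G : cumulativeBounded (0 : R) (1 : R)) n (f0 f1 : R -> R) (J : set TR)
    (kappa beta rad : R) (theta : n.-tuple TR * n.-tuple TR -> R) :
  has_density_on [set: R] Q phi -> 0 <= M ->
  (forall a : R, (\int[lebesgue_measure]_y
       ((Num.sqrt (phi (y - a)) - Num.sqrt (phi y)) ^+ 2)%:E
     <= (M * a ^+ 2)%:E)%E) ->
  nondecreasing_on_itv f0 -> nondecreasing_on_itv f1 -> measurable J ->
  (forall u, u \in `[-1, 1] -> `|f0 u - f1 u| <= kappa * \1_J u) -> 0 <= kappa ->
  2 * rad <= `|f1 0 - f0 0| -> 0 < beta < 1 / 2 ->
  ((M * kappa ^+ 2 * n%:R)%:E * law_of_cdf G J < ((1 - 2 * beta) ^+ 2)%:E)%E ->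
  measurable_fun [set: n.-tuple TR * n.-tuple TR] theta ->
  (beta%:E <= max_error_prob G Q f0 f1 theta rad)%E.
Proof.
move=> Q_dens M0 hel nd0 nd1 mJ close k0 sep /andP[b0 b1] info mtheta.
set A0 : set (n.-tuple TR * n.-tuple TR) := [set yx | rad <= `|theta yx - f0 0|].
set A1 : set (n.-tuple TR * n.-tuple TR) := [set yx | rad <= `|theta yx - f1 0|].
rewrite leNgt; apply/negP; rewrite /max_error_prob gt_max => /andP[lt0 lt1].
have mA0 : measurable A0.
  apply: measurable_bool_set; apply: measurable_fun_ler => //.
  by apply: measurableT_comp => //; exact: measurable_funB.
have A01 : ~` A0 `<=` A1.
  move=> yx /negP; rewrite -ltNge /A1 /= => near0; rewrite leNgt; apply/negP => near1.
  have : `|f1 0 - f0 0| <= `|theta yx - f0 0| + `|theta yx - f1 0|.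
    have -> : f1 0 - f0 0 = (theta yx - f0 0) - (theta yx - f1 0) by ring.
    exact: ler_normB.
  by lra.
have {}lt1 : (data_law G Q f1 (~` A0) <= beta%:E)%E.
  by apply: le_trans (@data_law_mono G Q n f1 _ _ A01) _; exact: ltW.
have close' u : `|(f0 \_ `[-1, 1]) u - (f1 \_ `[-1, 1]) u| <= kappa * \1_J u.
  rewrite !patchE; case: ifPn => [|_]; first by rewrite inE; exact: close.
  by rewrite subrr normr0 mulr_ge0.
pose s : R := (2 * beta)^-1.
have s1 : 1 < s by rewrite /s invf_gt1 ?mulr_gt0//; lra.
have := two_point_inequality Q_dens M0 hel G
  (nondecreasing_on_itv_measurable nd0) (nondecreasing_on_itv_measurable nd1)
  mJ mA0 s1 close'.
apply/negP; rewrite -ltNge.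
have ds : 0 <= s - s^-1 by rewrite subr_ge0 (le_trans _ (ltW s1))// invf_le1 ?(ltW s1)// (lt_trans _ s1).
apply: (@le_lt_trans _ _ ((2 / s)%:E + (s - s^-1)%:E * (beta + beta)%:E +
   (M * kappa ^+ 2 * n%:R)%:E * law_of_cdf G J)%E).
  apply: leeD => //; apply: leeD => //; apply: lee_wpmul2l; first by rewrite lee_fin.
  by rewrite EFinD; apply: leeD => //; exact: ltW.
apply: (@lt_le_trans _ _ ((2 / s)%:E + (s - s^-1)%:E * (beta + beta)%:E +
   ((1 - 2 * beta) ^+ 2)%:E)%E); first by rewrite lteD2lE.
rewrite -EFinM -!EFinD lee_fin /s invrK le_eqVlt; apply/orP; left; apply/eqP.
by field; rewrite gt_eqF.
Qed.

End model_facts.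

(** * Choice of the constants *)

Lemma deviation_bound_le (R : realType) (b c alpha v x : R) :
  0 < b -> 0 < c -> 0 < alpha -> 0 < x -> 0 <= v -> 32 / (b * alpha) <= x ->
  16 / (b * x) + 8 * v / (b * x * ((1 + 16 * v / (b * c ^+ 2 * alpha)) ^+ 2 *
    (c ^+ 2 / x))) <= alpha.
Proof.
move=> b0 c0 alpha0 x0 v0 x_ge.
have bca0 : 0 < b * c ^+ 2 * alpha by rewrite mulr_gt0// mulr_gt0// exprn_gt0.
have q0 : 0 <= 16 * v / (b * c ^+ 2 * alpha).
  by rewrite divr_ge0 ?(ltW bca0)// mulr_ge0.
have -> : 16 / (b * x) = alpha / 2 * (32 / (b * alpha) / x).
  by field; rewrite !gt_eqF.
have h1 : 32 / (b * alpha) / x <= 1 by rewrite ler_pdivrMr// mul1r.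
have vE : v = 16 * v / (b * c ^+ 2 * alpha) * (b * c ^+ 2 * alpha) / 16.
  by field; rewrite !gt_eqF.
set q := 16 * v / _ in q0 vE *.
have L0 : 0 < 1 + q by lra.
have -> : 8 * v / (b * x * ((1 + q) ^+ 2 * (c ^+ 2 / x))) = alpha / 2 * (q / (1 + q) ^+ 2).
  by rewrite vE; field; rewrite !gt_eqF.
have h2 : q / (1 + q) ^+ 2 <= 1 by rewrite ler_pdivrMr ?exprn_gt0// mul1r; nra.
by clear -h1 h2 alpha0; nra.
Qed.

Theorem theorem5p2 (R : realType) (f0 : R -> R)
  (f0_nd : nondecreasing_on_itv f0)
  (f0_cont : {for 0, continuous f0})
  (Q : probability (measurableTypeR R) R) (sigma M : R) (phi : R -> R)
  (Q_int : Q.-integrable [set: R] (EFin \o idfun))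
  (Q_mean : ('E_Q[idfun] = 0)%E)
  (Q_var : ('V_Q[idfun] = (sigma ^+ 2)%:E)%E)
  (Q_dens : has_density_on [set: R] Q phi)
  (M_gt0 : 0 < M)
  (phi_hellinger : forall a : R,
    (\int[lebesgue_measure]_y
       ((Num.sqrt (phi (y - a)) - Num.sqrt (phi y)) ^+ 2)%:E
     <= (M * a ^+ 2)%:E)%E)
  (G : cumulativeBounded (0 : R) (1 : R)) (g : R -> R) (U : set R)
  (G_supp : law_of_cdf G `[-1, 1]%classic = 1%E)
  (U_nbhs : open_nbhs 0 U)
  (G_dens : has_density_on U (law_of_cdf G) g)
  (g_cont : {for 0, continuous g})
  (g0_gt0 : 0 < g 0)
  (alpha beta : R)
  (alpha01 : 0 < alpha < 1)
  (beta012 : 0 < beta < 1 / 2) :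
  exists2 eta : R, 0 < eta &
  exists (f1 : nat -> R -> R) (gamma : nat -> R),
  [/\ \forall n \near \oo, nondecreasing_on_itv (f1 n) /\ 0 < gamma n,
      (limn_esup (fun n =>
         max_error_prob G Q f0 (f1 n) (lse (n := n) 0%R) (gamma n))
       <= alpha%:E)%E &
      (beta%:E < limn_einf (fun n =>
         ereal_inf [set max_error_prob G Q f0 (f1 n) theta (eta * gamma n)%R
                   | theta in [set theta : n.-tuple (measurableTypeR R) *
                                           n.-tuple (measurableTypeR R) -> R
                              | measurable_fun [set: _] theta]]))%E].
Proof.
have [sq_mean sq_var] := second_moments Q_mean Q_var.
have [b [B [b0 B0 mass]]] := design_mass U_nbhs G_dens g_cont g0_gt0.
have /andP[alpha0 alpha1] := alpha01; have /andP[beta0 beta1] := beta012.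
(* The liminf has to exceed beta strictly. *)
pose beta' := (beta + 1 / 2) / 2.
have beta'_gt : beta < beta' by rewrite /beta'; lra.
have beta'01 : 0 < beta' < 1 / 2 by rewrite /beta'; apply/andP; split; lra.
have MB0 : 0 < M * B by exact: mulr_gt0.
(* Small enough for the two-point inequality at level beta': the loss of
   affinity is at most M B c^2 / 16 < (1 - 2 beta')^2. *)
pose c := (1 - 2 * beta') / (1 + M * B).
have num0 : 0 < 1 - 2 * beta' by case/andP: beta'01 => _ ?; lra.
have den0 : 0 < 1 + M * B by lra.
have c0 : 0 < c by exact: divr_gt0.
(* The error probability contributed by the errors is
   8 sigma^2 / (b L^2 c^2), which is at most alpha / 2 as L^2 >= q. *)
pose q := 16 * sigma ^+ 2 / (b * c ^+ 2 * alpha).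
have bca0 : 0 < b * c ^+ 2 * alpha by rewrite mulr_gt0// mulr_gt0// exprn_gt0.
have q0 : 0 <= q by rewrite divr_ge0 ?(ltW bca0)// mulr_ge0// sqr_ge0.
pose L := 1 + q.
have L0 : 0 < L by rewrite /L; lra.
have L3 : 0 < 3 + L by lra.
(* The part contributed by the design is 16 / (b n delta), which is at
   most alpha / 2 as soon as n delta >= K; the second summand of K
   ensures that the windows contain enough design points. *)
pose K := 32 / (b * alpha) + 4 / b.
have K1 : 0 < 32 / (b * alpha) by rewrite divr_gt0// mulr_gt0.
have K2 : 0 < 4 / b by rewrite divr_gt0.
have K0 : 0 < K by rewrite addr_gt0.
exists (8 * (3 + L))^-1; first by rewrite invr_gt0 mulr_gt0.
have ex_alt (n : nat) : exists p : R * (R -> R), (0 < n)%N ->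
    let w := rate n c p.1 in
    [/\ 0 < p.1 <= 1, f0 p.1 <= f0 0 + w, f0 0 - w <= f0 (- p.1),
        close_alternative f0 p.1 (w / 4) w p.2 &
        p.1 = 1 \/ 2 * p.1 <= 1 /\ w / 2 < f0 (2 * p.1) - f0 (- (2 * p.1))].
  have [->|n0] := posnP n; first by exists (0, id).
  by have [delta [f1 H]] := local_alternative f0_nd n0 c0; exists (delta, f1).
have [p pP] := choice ex_alt.
exists (fun n => (p n).2), (fun n => (3 + L) * rate n c (p n).1).
have rate_gt0 n : (0 < n)%N -> 0 < rate n c (p n).1.
  move=> n0; have [/andP[d0 _] _ _ _ _] := pP n n0.
  by rewrite divr_gt0// sqrtr_gt0 mulr_gt0// ltr0n.
have rate_sqr n : (0 < n)%N -> rate n c (p n).1 ^+ 2 = c ^+ 2 / (n%:R * (p n).1).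
  move=> n0; have [/andP[d0 _] _ _ _ _] := pP n n0.
  by rewrite expr_div_n sqr_sqrtr// mulr_ge0// ltW.
have near_gt0 : \forall n \near \oo, (0 < n)%N by exists 1%N.
have near_K : \forall n \near \oo, (0 < n)%N /\ K <= n%:R * (p n).1.
  have big := bandwidth_not_too_small f0_cont c0 K0.
  apply: filterS2 near_gt0 big => n n0 big; split => //.
  by have [/andP[d0 _] _ _ _ crit] := pP n n0; exact: big.
split.
- apply: filterS near_gt0 => n n0; have [_ _ _ [nd1 _ _ _ _] _] := pP n n0.
  by split => //; rewrite mulr_gt0// rate_gt0.
- apply: limn_esup_le_near; apply: filterS near_K => n [n0 Kn].
  have [d01 fR fL [nd1 _ _ f1R f1L] _] := pP n n0.
  have w0 := rate_gt0 n n0; have w2 := rate_sqr n n0.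
  have /andP[d0 d1] := d01; have [mR mL _] := mass _ d01.
  move: fR fL nd1 f1R f1L w0 w2; set w := rate _ _ _; set delta := (p n).1 in d0 d1 d01 mR mL Kn *.
  move=> fR fL nd1 f1R f1L w0 w2.
  set x := n%:R * delta in w2 Kn.
  have x0 : 0 < x by exact: lt_le_trans Kn.
  have np4 : 4 <= n%:R * (b * delta).
    have : 4 / b <= x by rewrite (le_trans _ Kn)// lerDr ltW.
    by rewrite ler_pdivrMr// mulrC mulrCA -/x.
  have error_le (f : R -> R) : nondecreasing_on_itv f ->
      f delta <= f 0 + 2 * w -> f 0 - 2 * w <= f (- delta) ->
      (data_law G Q f [set yx : n.-tuple (measurableTypeR R) * n.-tuple (measurableTypeR R) |
        ((3 + L) * w <= `|lse 0 yx - f 0|)%R] <= alpha%:E)%E.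
    move=> nd fr fl.
    apply: le_trans (lse_deviation (r := L * w) Q_int sq_mean sq_var G_supp nd
      d01 fr fl _ _ _ np4 mR mL) _.
    - exact: mulr_gt0.
    - by clear -w0; lra.
    - exact: mulr_gt0.
    rewrite lee_fin exprMn w2 mulrCA -/x; apply: deviation_bound_le => //.
      exact: sqr_ge0.
    by rewrite (le_trans _ Kn)// lerDl ltW.
  rewrite /max_error_prob ge_max; apply/andP; split; apply: error_le => //;
    by clear -fR fL f1R f1L w0; lra.
- apply: (@lt_le_trans _ _ beta'%:E); first by rewrite lte_fin.
  apply: limn_einf_ge_near; apply: filterS near_gt0 => n n0.
  have [d01 _ _ [nd1 sep close _ _] _] := pP n n0.
  have w0 := rate_gt0 n n0; have w2 := rate_sqr n n0.
  have /andP[d0 d1] := d01; have [_ _ mJ] := mass _ d01.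
  move: nd1 sep close w0 w2; set w := rate _ _ _; set delta := (p n).1 in d0 d1 d01 mJ *.
  move=> nd1 sep close w0 w2.
  apply: le_ereal_inf_tmp => _ [theta mtheta <-].
  have n0' : 0 < n%:R :> R by rewrite ltr0n.
  apply: (minimax_two_point (J := [set u | `|u| <= 2 * delta]) (kappa := w / 4) Q_dens
    (ltW M_gt0) phi_hellinger f0_nd nd1 _ close _ _ beta'01 _ mtheta).
  + by apply: measurable_bool_set; exact: measurable_fun_ler.
  + by rewrite divr_ge0 // ltW.
  + rewrite sep; have -> : 2 * ((8 * (3 + L))^-1 * ((3 + L) * w)) = w / 4.
      by field; rewrite gt_eqF.
    by [].
  apply: (@le_lt_trans _ _ ((M * (w / 4) ^+ 2 * n%:R)%:E * (B * delta)%:E)%E).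
    by apply: lee_wpmul2l => //; rewrite lee_fin mulr_ge0// mulr_ge0 ?sqr_ge0// ltW.
  rewrite -EFinM lte_fin expr_div_n w2.
  have -> : M * (c ^+ 2 / (n%:R * delta) / 4 ^+ 2) * n%:R * (B * delta) =
      (1 - 2 * beta') ^+ 2 * (M * B / (1 + M * B) ^+ 2 / 16).
    by rewrite /c; field; rewrite !gt_eqF.
  rewrite -[ltRHS]mulr1 ltr_pM2l; last exact: exprn_gt0.
  by rewrite ltr_pdivrMr// mul1r ltr_pdivrMr ?exprn_gt0 ?addr_gt0//; nra.
Qed.
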